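(* Let $n\ge 1$ and let ${\boldsymbol{\alpha}}=(\alpha_2,\alpha_3,\ldots)$ be a sequence of nonnegative integers with finitely many nonzero entries and $\sum_{j\ge2}(j-1)\alpha_j=n-1$. Then the equivalence classes of minimal factorizations of type ${\boldsymbol{\alpha}}$ of the $n$-cycle $(1\,2\,\ldots\,n)$ are in one-to-one correspondence with undirected rooted plane trees having exactly $\alpha_j$ vertices of degree $2j$ for each $j\ge 2$ and $2n$ leaves (vertices of degree $1$), and no other vertices.
   Context: Permutations are multiplied right to left: in a product $\sigma_m\cdots\sigma_1$ the factor $\sigma_1$ is applied first. A factorization of the cycle $(1\,2\,\ldots\,n)$ is an expression $(1\,2\,\ldots\,n)=\sigma_m\cdots\sigma_1$ where each $\sigma_i$ is a cycle of length at least $2$. It is of type ${\boldsymbol{\alpha}}=(\alpha_2,\alpha_3,\ldots)$ if exactly $\alpha_j$ of the factors are $j$-cycles. One always has $\sum_{j\ge2}(j-1)\alpha_j\ge n-1$, and the factorization is called minimal if equality holds. Two factorizations are equivalent if one can be obtained from the other by repeatedly swapping adjacent commuting factors (i.e. they differ only in the order of commuting factors). In the trees, the root is one of the leaves, and the plane structure means the cyclic order of edges around each vertex is part of the data. *)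

(* Defs.v *)
From mathcomp Require Import all_boot all_fingroup.
Set Implicit Arguments. Unset Strict Implicit. Unset Printing Implicit Defensive.

Local Open Scope group_scope.

Definition ncycle (n : nat) : {perm 'I_n} := perm (@ordS_inj n).

Definition psupp (n : nat) (s : {perm 'I_n}) : {set 'I_n} := [set x | s x != x].

Definition is_cycle_ge2 (n : nat) (s : {perm 'I_n}) : bool :=
  (2 <= #|psupp s|)%N && [exists x, porbit s x == psupp s].

Definition cyc_len (n : nat) (s : {perm 'I_n}) : nat := #|psupp s|.

(* A factorization sigma_m ... sigma_1 (sigma_1 applied first) is encoded by the
   list fs = [:: sigma_1; ...; sigma_m].  MathComp multiplies permutations
   left-to-right ((s * t) x = t (s x)), so the composite sigma_m o ... o sigma_1
   is exactly \prod_(s <- fs) s. *)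
Definition is_factorization (n : nat) (fs : seq {perm 'I_n}) : Prop :=
  all (@is_cycle_ge2 n) fs /\ \prod_(s <- fs) s = ncycle n.

Definition of_type (n : nat) (alpha : nat -> nat) (fs : seq {perm 'I_n}) : Prop :=
  forall j, (2 <= j)%N -> count (fun s => cyc_len s == j) fs = alpha j.

Definition is_minimal (n : nat) (fs : seq {perm 'I_n}) : Prop :=
  sumn (map (fun s => (cyc_len s).-1) fs) = n.-1.

Definition min_fact_of_type (n : nat) (alpha : nat -> nat) (fs : seq {perm 'I_n}) : Prop :=
  is_factorization fs /\ of_type alpha fs /\ is_minimal fs.

Definition swap_step (n : nat) (fs gs : seq {perm 'I_n}) : Prop :=
  exists (a b : seq {perm 'I_n}) (s t : {perm 'I_n}),
    [/\ fs = a ++ s :: t :: b, gs = a ++ t :: s :: b & s * t = t * s].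

Inductive fequiv (n : nat) : seq {perm 'I_n} -> seq {perm 'I_n} -> Prop :=
| fequiv_refl fs : fequiv fs fs
| fequiv_step fs gs : swap_step fs gs -> fequiv fs gs
| fequiv_sym fs gs : fequiv fs gs -> fequiv gs fs
| fequiv_trans fs gs hs : fequiv fs gs -> fequiv gs hs -> fequiv fs hs.

(* A rooted plane tree is encoded as an ordered tree: each vertex carries the
   linearly ordered list of its children (for a non-root vertex, the cyclic order
   around it, cut at the edge to its parent; for the root, the cyclic order cut at
   a distinguished edge -- here the root is a leaf, so it has a single edge and no
   choice is involved). Isomorphism classes of plane trees rooted at a leaf are in
   bijection with such terms whose root has exactly one child. *)
Inductive ptree : Type := PNode of seq ptree.

Definition children (t : ptree) : seq ptree := let: PNode ts := t in ts.

(* Number of non-root vertices of the subtree t whose degree (= #children + 1,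
   counting the edge to the parent) satisfies P. *)
Fixpoint cnt_nonroot (P : pred nat) (t : ptree) : nat :=
  let: PNode ts := t in P (size ts).+1 + sumn (map (cnt_nonroot P) ts).

Definition cnt_deg (P : pred nat) (T : ptree) : nat :=
  let: PNode ts := T in P (size ts) + sumn (map (cnt_nonroot P) ts).

Definition tree_of_type (n : nat) (alpha : nat -> nat) (T : ptree) : Prop :=
  [/\ size (children T) = 1%N,
      cnt_deg (fun d => d == 1%N) T = (2 * n)%N,
      (forall j, (2 <= j)%N -> cnt_deg (fun d => d == (2 * j)%N) T = alpha j) &
      cnt_deg (fun d => ~~ ((d == 1%N) || (~~ odd d && (4 <= d)%N))) T = 0%N].

(* Main.v *)
Require Import Defs.
From mathcomp Require Import all_boot all_fingroup.
From mathcomp Require Import zify.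
Set Implicit Arguments. Unset Strict Implicit. Unset Printing Implicit Defensive.

(* The tree of a class is built recursively.  Given a minimal factorization of the
   cycle w = (x ...), let s = (x a_1 ... a_k) be the last factor that moves x.  Deleting s
   splits the other factors into 2k + 1 groups: those tied to x, and, for each a_i,
   those tied to a_i that act after s and those that act before it.  The groups are
   minimal factorizations of cycles on consecutive segments
     x v,  u_1 a_1,  a_1 v_1,  ...,  u_k a_k,  a_k v_k
   of w = x v u_1 a_1 v_1 ... u_k a_k v_k, and their trees are the children of the
   vertex s, which has degree 2(k + 1).

   Surjectivity is proved by peeling the first factor (b b_1 ... b_k) off a minimal
   factorization: the remaining factors factor a product of k + 1 disjoint cycles
   minimally, hence split into commuting minimal factorizations of those cycles (count
   orbits), and the first factor is put back by growing a node at a leaf b.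
   Injectivity holds because s is read off the class (it commutes with no earlier
   factor that moves x), and the product of the other factors shows where the segments
   are cut. *)

Local Open Scope group_scope.

(** * Words and multiplicities *)

(** Named copies of [count_mem] and, in [eqo], of [==], so that the tactic [cnt] can find by pattern
    the terms it hands to [lia]. *)
Definition mult (n : nat) (x : 'I_n) (s : seq 'I_n) : nat := count_mem x s.
Definition eqo (n : nat) (x y : 'I_n) : bool := x == y.

Lemma eqoE n (x y : 'I_n) : (x == y) = eqo x y. Proof. by []. Qed.
Lemma eqoxx n (x : 'I_n) : eqo x x = true. Proof. exact: eqxx. Qed.
Lemma mult_nil n (x : 'I_n) : mult x [::] = 0. Proof. by []. Qed.
Lemma mult_cons n (x y : 'I_n) s : mult x (y :: s) = (eqo y x + mult x s)%N.
Proof. by []. Qed.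
Lemma mult_cat n (x : 'I_n) s1 s2 : mult x (s1 ++ s2) = (mult x s1 + mult x s2)%N.
Proof. exact: count_cat. Qed.
Lemma mult_rcons n (x y : 'I_n) s : mult x (rcons s y) = (mult x s + eqo y x)%N.
Proof. by rewrite -cats1 mult_cat mult_cons addn0. Qed.
Lemma mem_mult n (x : 'I_n) s : (x \in s) = (0 < mult x s)%N.
Proof. by rewrite /mult -has_pred1 has_count. Qed.

Lemma uniq_multP n (s : seq 'I_n) : reflect (forall x, mult x s <= 1)%N (uniq s).
Proof.
apply: (iffP idP) => [Us x|le1]; first by rewrite /mult count_uniq_mem // leq_b1.
by apply: count_mem_uniq => x; rewrite mem_mult; have := le1 x; rewrite /mult; case: count => [|[]].
Qed.

(* Membership and duplicate-freeness of concatenated words are both statements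
   about multiplicities of a letter z, which linear arithmetic decides. *)
Ltac cnt z :=
  repeat match goal with H : is_true (uniq ?s) |- _ =>
    move/uniq_multP/(_ z): H => H end;
  repeat match goal with
  | H : context [_ \in _] |- _ => rewrite mem_mult in H
  | H : context [mult _ (_ ++ _)] |- _ => rewrite mult_cat in H
  | H : context [mult _ (rcons _ _)] |- _ => rewrite mult_rcons in H
  | H : context [mult _ (_ :: _)] |- _ => rewrite mult_cons in H
  | H : context [mult _ [::]] |- _ => rewrite mult_nil in H
  | H : context [eqo ?x ?x] |- _ => rewrite eqoxx in H
  end;
  rewrite ?mem_mult ?(mult_cat, mult_rcons, mult_cons, mult_nil) ?eqoE ?eqoxx;
  repeat match goal with
  | H : context [mult _ _] |- _ => revert H
  | H : context [eqo _ _] |- _ => revert H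
  end;
  clear; lia.

Ltac ucnt := let z := fresh "z" in apply/uniq_multP => z; cnt z.

(** * Cycles given by words *)

(** A star of transpositions: for a word without repetition the first one carries x to the second
    letter, which the later ones fix, and so on around the word ([cycE]). In this form concatenation
    behind a common head is a product ([cyc_cat]), and orbits can be counted one transposition at a
    time. *)
Definition cyc (n : nat) (w : seq 'I_n) : {perm 'I_n} :=
  if w is x :: u then \prod_(y <- u) tperm x y else 1.

Lemma cyc1 n (x : 'I_n) : cyc [:: x] = 1.
Proof. exact: big_nil. Qed.

Lemma cyc_cat n (x : 'I_n) u v : cyc (x :: u ++ v) = cyc (x :: u) * cyc (x :: v).
Proof. exact: big_cat. Qed.

Lemma cyc_cons n (x y : 'I_n) u : cyc (x :: y :: u) = tperm x y * cyc (x :: u).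
Proof. exact: big_cons. Qed.

Lemma cycJ n (w : seq 'I_n) s : cyc w ^ s = cyc (map s w).
Proof.
case: w => [|x u] /=; first exact: conj1g.
by rewrite conjg_prod big_map; apply: eq_bigr => y _; rewrite tpermJ.
Qed.

Arguments cyc : simpl never.

Lemma cyc_out n (w : seq 'I_n) z : z \notin w -> cyc w z = z.
Proof.
case: w => [|x u]; first by rewrite perm1.
elim: u => [|y u IHu] zw; first by rewrite cyc1 perm1.
rewrite cyc_cons permM tpermD ?IHu //; move: zw; rewrite !inE !negb_or.
- by case/and3P=> -> _ ->.
- by case/and3P; rewrite eq_sym.
- by case/and3P; rewrite (eq_sym y).
Qed.

Lemma cyc_head n (x y : 'I_n) u : uniq (x :: y :: u) -> cyc (x :: y :: u) x = y.
Proof.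
move=> U; rewrite cyc_cons permM tpermL cyc_out //; cnt y.
Qed.

Lemma map_tperm n (x y : 'I_n) u :
  x \notin u -> y \notin u -> map (tperm x y) u = u.
Proof.
move=> xu yu; rewrite -[RHS]map_id; apply/eq_in_map => z zu.
by rewrite tpermD //; [apply: contraNneq xu => ->|apply: contraNneq yu => ->].
Qed.

(** Conjugation by [tperm x y] turns [cyc (y :: u)] into [cyc (x :: u)], so the transposition can be
    moved from the right end of the product to the left. *)
Lemma cyc_rot1 n (x : 'I_n) u : uniq (x :: u) -> cyc (rcons u x) = cyc (x :: u).
Proof.
case: u => [|y u] U //; rewrite rcons_cons -cats1 cyc_cat cyc_cons cyc_cons cyc1 mulg1.
have /(congr1 (fun s => tperm x y * s)) := cycJ (y :: u) (tperm x y).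
have xu : x \notin u by cnt x.
have yu : y \notin u by cnt y.
rewrite /= tpermR map_tperm //.
by rewrite conjgE tpermV mulgA tpermC mulgA tperm2 mul1g => <-.
Qed.

Lemma cyc_rot n (p q : seq 'I_n) : uniq (p ++ q) -> cyc (q ++ p) = cyc (p ++ q).
Proof.
elim: p q => [|x p IHp] q; first by rewrite cats0.
move=> U; rewrite -cat_rcons IHp; last by ucnt.
by rewrite -rcons_cat cyc_rot1.
Qed.

Lemma cycE n (w : seq 'I_n) : uniq w -> cyc w =1 next w.
Proof.
move=> U z; have [zw|zw] := boolP (z \in w); last first.
  by rewrite cyc_out // next_nth (negbTE zw).
case: (splitPr zw) U => p q U; rewrite -cyc_rot // -(next_rot (size p) U) rot_size_cat.
have U' : uniq ((z :: q) ++ p) by ucnt.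
case: {U zw} (q ++ p) U' (cat_cons z q p) => [|b r] U' E; rewrite E in U' *.
  by rewrite cyc1 perm1 /= eqxx.
by rewrite cyc_head //= eqxx.
Qed.

Lemma cyc_next n (p q : seq 'I_n) a b : uniq (p ++ a :: b :: q) ->
  cyc (p ++ a :: b :: q) a = b.
Proof. move=> U; rewrite -cyc_rot //= cyc_head //; ucnt. Qed.

Lemma cyc_last n (x : 'I_n) u : uniq (x :: u) -> cyc (x :: u) (last x u) = x.
Proof.
case/lastP: u => [|u y] U; first by rewrite cyc1 perm1.
rewrite last_rcons -rcons_cons cyc_rot1 ?cyc_head //; ucnt.
Qed.

Lemma cyc_neq n (w : seq 'I_n) z : uniq w -> (1 < size w)%N -> z \in w -> cyc w z != z.
Proof.
move=> U sw zw; case: (splitPr zw) U sw => p q U; rewrite size_cat => sw.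
rewrite -cyc_rot //; have {U} : uniq ((z :: q) ++ p) by ucnt.
rewrite cat_cons; case E : (q ++ p) => [|b r] U.
  by have := congr1 size E; rewrite size_cat /=; move: sw => /=; lia.
rewrite cyc_head //; cnt z.
Qed.

Lemma psupp_cyc n (w : seq 'I_n) : uniq w -> (1 < size w)%N -> psupp (cyc w) =i w.
Proof.
move=> U sw z; rewrite inE; have [zw|zw] := boolP (z \in w); first exact: cyc_neq.
by rewrite cyc_out ?eqxx.
Qed.

Lemma cyc_len_cyc n (w : seq 'I_n) : uniq w -> (1 < size w)%N -> cyc_len (cyc w) = size w.
Proof. by move=> U sw; rewrite /cyc_len (eq_card (psupp_cyc U sw)); apply/card_uniqP. Qed.

Lemma cyc_len_pred n (w : seq 'I_n) : uniq w -> (cyc_len (cyc w)).-1 = (size w).-1.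
Proof.
move=> U; have [sw|] := ltnP 1 (size w); first by rewrite cyc_len_cyc.
case: w U => [|x [|//]] _ _; rewrite ?cyc1 /cyc_len (_ : psupp _ = set0) ?cards0 //.
- by apply/setP=> z; rewrite !inE perm1 eqxx.
- by apply/setP=> z; rewrite !inE perm1 eqxx.
Qed.

Lemma porbit_cyc n (w : seq 'I_n) x : uniq w -> x \in w -> porbit (cyc w) x =i w.
Proof.
move=> U xw y; have fw : fcycle (cyc w) w.
  have := cycle_next U; apply: sub_cycle => a b /=.
  by rewrite cycE.
rewrite -(fconnect_cycle fw xw y); apply/porbitP/idP => [[i ->]|/iter_findex <-].
  by rewrite permX fconnect_iter.
by exists (findex (cyc w) x y); rewrite permX.
Qed.

Lemma porbit_cyc_out n (w : seq 'I_n) x y :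
  x \notin w -> (y \in porbit (cyc w) x) = (y == x).
Proof.
move=> xw; apply/porbitP/eqP => [[i ->]|->]; last by exists 0; rewrite expg0 perm1.
by elim: i => [|i IHi]; rewrite ?expg0 ?perm1 // expgSr permM IHi cyc_out.
Qed.

Lemma is_cycle_cyc n (w : seq 'I_n) : uniq w -> (1 < size w)%N -> is_cycle_ge2 (cyc w).
Proof.
move=> U sw; rewrite /is_cycle_ge2 -/(cyc_len _) cyc_len_cyc // sw /=.
case: w U sw => [|x u] // U sw; apply/existsP; exists x; apply/eqP/setP => y.
by rewrite porbit_cyc ?mem_head // psupp_cyc.
Qed.

Lemma is_cycle_cycP n (s : {perm 'I_n}) : is_cycle_ge2 s ->
  exists w, [/\ uniq w, (1 < size w)%N & s = cyc w].
Proof.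
case/andP=> ge2 /existsP[x /eqP ox]; set w := traject s x #|porbit s x|.
have U : uniq w := uniq_traject_porbit s x.
exists w; rewrite size_traject ox; split => //; apply/permP => y.
have [yw|yw] := boolP (y \in w); last first.
  rewrite cyc_out //; move: yw; rewrite -porbit_traject ox inE negbK; exact/eqP.
rewrite cycE //; have fw : fcycle s w.
  rewrite /w; have := iter_porbit s x; case: #|_| => // k E.
  by rewrite trajectS [fcycle _ _]/= -{3}E iterSr -trajectSr; exact: fpath_traject.
exact/eqP/(next_cycle fw yw).
Qed.

Lemma cyc_inj n (x : 'I_n) u v : uniq (x :: u) -> uniq (x :: v) ->
  cyc (x :: u) = cyc (x :: v) -> u = v.
Proof.
elim: u v => [|a u IHu] [|b v] Uu Uv E //.
- by have := cyc_neq Uv isT (mem_head x _); rewrite -E cyc1 perm1 eqxx.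
- by have := cyc_neq Uu isT (mem_head x _); rewrite E cyc1 perm1 eqxx.
have ab : a = b by rewrite -(cyc_head Uu) E cyc_head.
rewrite -ab !cyc_cons in E; congr (_ :: _) => //; apply: IHu; first by ucnt.
- by rewrite ab in Uu; ucnt.
- exact: mulgI E.
Qed.

(** * Orbits of products of cycles *)

Lemma porbit_image n (s : {perm 'I_n}) x : s x \in porbit s x.
Proof. exact: (mem_porbit s 1). Qed.

Definition orbs (n : nat) (s : {perm 'I_n}) : nat := #|porbits s|.

Ltac rlia := rewrite /=; do ?[move: (orbs _) => ?]; clear; lia.

Lemma orbs_mul_tperm n (s : {perm 'I_n}) x y : x != y ->
  (orbs (tperm x y * s) + (x \notin porbit s y).*2 = (orbs s).+1)%N.
Proof. by move=> xy; have := porbits_mul_tperm s x y; rewrite /= xy addn1. Qed.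

(** Each of the [size u] transpositions merges two orbits or splits one, so it lowers the count by
    at most one. *)
Lemma porbits_cyc_mul n (x : 'I_n) u g : uniq (x :: u) ->
  (orbs g <= orbs (cyc (x :: u) * g) + size u)%N.
Proof.
elim: u => [|y u IHu] U; first by rewrite cyc1 mul1g addn0.
rewrite cyc_cons -mulgA; have xy : x != y by cnt y.
have Uu : uniq (x :: u) by ucnt.
have := orbs_mul_tperm (cyc (x :: u) * g) xy; have := IHu Uu.
rewrite /=; rlia.
Qed.

(** Equality forces every transposition to merge. With z rotated to the head, the outermost
    transposition exchanges z and its image; if these lay in different orbits of the product, it
    would have split an orbit, and the other transpositions would have to lower the count by more
    than [porbits_cyc_mul] allows. *)
Lemma porbits_cyc_mul_eq n (w : seq 'I_n) g z : uniq w ->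
  (orbs (cyc w * g) + (size w).-1 = orbs g)%N ->
  cyc w z \in porbit (cyc w * g) z.
Proof.
move=> U; have [zw E|zw _] := boolP (z \in w); last by rewrite cyc_out ?porbit_id.
case: (splitPr zw) U E => p q U; rewrite -cyc_rot //.
have -> : size (p ++ z :: q) = size ((z :: q) ++ p) by rewrite !size_cat addnC.
have {U} : uniq ((z :: q) ++ p) by ucnt.
rewrite cat_cons; case: {zw} (q ++ p) => [|y u] U /= E.
  by rewrite cyc1 perm1 porbit_id.
rewrite cyc_head //; move: E; rewrite cyc_cons -mulgA; set t := tperm z y.
have zy : z != y by cnt y.
have Uu : uniq (z :: u) by ucnt.
have := orbs_mul_tperm (cyc (z :: u) * g) zy.
have := orbs_mul_tperm (t * (cyc (z :: u) * g)) zy.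
have := porbits_cyc_mul g Uu.
rewrite -/t tpermKg => h1 h2 h3 E.
rewrite porbit_sym; apply: contraT => out; move: h2 h1 h3 E; rewrite out; rlia.
Qed.

(** Each letter y of u is a singleton orbit of the product to the right of [tperm x y], which
    therefore merges it into the orbit of x. *)
Lemma porbits_cyc_fix n (x : 'I_n) u (h : {perm 'I_n}) : uniq (x :: u) -> {in u, h =1 id} ->
  (orbs (cyc (x :: u) * h) + size u = orbs h)%N.
Proof.
elim: u => [|y u IHu] U hu; first by rewrite cyc1 mul1g addn0.
have Uu : uniq (x :: u) by ucnt.
have hu' : {in u, h =1 id} by move=> z zu; apply: hu; rewrite inE zu orbT.
have xy : x != y by cnt y.
have := orbs_mul_tperm (cyc (x :: u) * h) xy; rewrite /= -(IHu Uu hu').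
have -> : x \notin porbit (cyc (x :: u) * h) y.
  apply: contra xy => /porbitP[i ->]; apply/eqP.
  have fy : (cyc (x :: u) * h) y = y.
    by rewrite permM cyc_out ?hu ?mem_head //; cnt y.
  by elim: i => [|i IHi]; rewrite ?expg0 ?perm1 // expgSr permM IHi.
by rewrite cyc_cons -mulgA; rlia.
Qed.

Lemma card_porbits1 n : orbs (1 : {perm 'I_n}) = n.
Proof.
rewrite /orbs /porbits card_imset ?card_ord // => x y /eqP.
rewrite eq_porbit_mem => /porbitP[i ->].
by rewrite expg1n perm1.
Qed.

Lemma porbits_cyc n (w : seq 'I_n) : w != [::] -> uniq w ->
  (orbs (cyc w) + (size w).-1 = n)%N.
Proof.
case: w => [|x u] // _ U; rewrite -[cyc _]mulg1 porbits_cyc_fix //.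
- exact: card_porbits1.
- by move=> z _; rewrite perm1.
Qed.

Lemma porbits_cyc2 n (w1 w2 : seq 'I_n) : w1 != [::] -> w2 != [::] ->
  uniq (w1 ++ w2) ->
  (orbs (cyc w1 * cyc w2) + (size w1).-1 + (size w2).-1 = n)%N.
Proof.
case: w1 => [|x u] // _ w2N U; have [U1 U2] : uniq (x :: u) /\ uniq w2 by split; ucnt.
rewrite porbits_cyc_fix ?porbits_cyc //.
by move=> z zu; rewrite cyc_out //; cnt z.
Qed.

(* The identity is allowed besides genuine cycles: peeling a transposition off a
   2-cycle produces it. *)
Definition is_cyc (n : nat) (s : {perm 'I_n}) : Prop :=
  exists x u, uniq (x :: u) /\ s = cyc (x :: u).

Lemma is_cycle_is_cyc n (s : {perm 'I_n}) : is_cycle_ge2 s -> is_cyc s.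
Proof. by case/is_cycle_cycP=> -[|x u] [U sw ->] //; exists x, u. Qed.

Definition wt (n : nat) (fs : seq {perm 'I_n}) : nat :=
  sumn (map (fun s => (cyc_len s).-1) fs).

Lemma wt_cat n (fs gs : seq {perm 'I_n}) : wt (fs ++ gs) = (wt fs + wt gs)%N.
Proof. by rewrite /wt map_cat sumn_cat. Qed.

(** The identity has n orbits, and each cycle removes at most its length minus one. *)
Lemma porbits_prod n (fs : seq {perm 'I_n}) : (forall s, s \in fs -> is_cyc s) ->
  (n <= orbs (\prod_(s <- fs) s) + wt fs)%N.
Proof.
elim: fs => [|s fs IHfs] cfs; first by rewrite big_nil card_porbits1 addn0.
have := IHfs (fun t tfs => cfs t (@mem_behead _ (s :: fs) t tfs)); rewrite big_cons.
have [x [u [U ->]]] := cfs s (mem_head _ _).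
have := porbits_cyc_mul (\prod_(t <- fs) t) U.
by rewrite /wt /= cyc_len_pred //=; rlia.
Qed.

(** Equality in the total bound is equality at every factor. The first factor t then keeps the
    orbits of [t * g]; so does g, which is [t^-1] followed by [t * g]. By induction the remaining
    factors keep the orbits of g, which lie inside those of [t * g]. *)
Lemma porbits_prod_eq n (fs : seq {perm 'I_n}) s z :
  (forall s, s \in fs -> is_cyc s) ->
  (orbs (\prod_(t <- fs) t) + wt fs)%N = n ->
  s \in fs -> s z \in porbit (\prod_(t <- fs) t) z.
Proof.
elim: fs s z => [|t fs IHfs] s z cfs //.
have cfs' r : r \in fs -> is_cyc r by move=> rfs; apply: cfs; rewrite inE rfs orbT.
rewrite big_cons; set g := \prod_(r <- fs) r => E.
have Et y : t y \in porbit (t * g) y.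
  have [x [u [U tE]]] := cfs t (mem_head _ _); rewrite tE; apply: porbits_cyc_mul_eq => //.
  have := porbits_prod cfs'; have := porbits_cyc_mul g U; move: E.
  by rewrite tE /wt /= cyc_len_pred // /g /=; rlia.
have gE : (orbs g + wt fs)%N = n.
  have [x [u [U tE]]] := cfs t (mem_head _ _).
  have := porbits_prod cfs'; have := porbits_cyc_mul g U; move: E.
  by rewrite tE /wt /= cyc_len_pred // /g /=; rlia.
rewrite inE => /predU1P[-> //|sfs].
have /porbitP[i ->] := IHfs s z cfs' gE sfs; rewrite -/g.
elim: i => [|i IHi]; first by rewrite expg0 perm1 porbit_id.
rewrite expgSr permM; set y := (g ^+ i) z in IHi *.
have -> : g y = (t * g) (t^-1 y) by rewrite permM permKV.
rewrite -eq_porbit_mem in IHi; rewrite -(eqP IHi) -eq_porbit_mem.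
have /eqP -> : porbit (t * g) ((t * g) (t^-1 y)) == porbit (t * g) (t^-1 y).
  by rewrite eq_porbit_mem porbit_image.
by rewrite eq_sym eq_porbit_mem -{1}(permKV t y) Et.
Qed.

(** * Supports and commutation classes *)

Definition supp_in (n : nat) (w : seq 'I_n) (s : {perm 'I_n}) : bool := psupp s \subset w.

Lemma supp_inP n (w : seq 'I_n) (s : {perm 'I_n}) :
  reflect (forall x, x \notin w -> s x = x) (supp_in w s).
Proof.
apply: (iffP subsetP) => [sw x|sw x]; last by rewrite inE; apply: contraR => /sw ->.
by apply: contraNeq => sx; apply: sw; rewrite inE.
Qed.

Lemma supp_in_cyc n (w : seq 'I_n) : supp_in w (cyc w).
Proof. by apply/supp_inP => x; exact: cyc_out. Qed.

Lemma supp_inS n (w1 w2 : seq 'I_n) s :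
  {subset w1 <= w2} -> supp_in w1 s -> supp_in w2 s.
Proof. by move=> sub /supp_inP fix1; apply/supp_inP => x xw; apply: fix1; apply: contra xw => /sub. Qed.

Lemma all_supp_inS n (w1 w2 : seq 'I_n) fs :
  {subset w1 <= w2} -> all (supp_in w1) fs -> all (supp_in w2) fs.
Proof. by move=> sub; apply: sub_all => s; exact: supp_inS. Qed.

Lemma supp_in_closed n (w : seq 'I_n) (s : {perm 'I_n}) x : supp_in w s -> (s x \in w) = (x \in w).
Proof.
move=> /supp_inP fixw; apply/idP/idP; last apply: contraLR.
- by apply: contraLR => xw; rewrite fixw.
- by move=> sxw; rewrite -(perm_inj (fixw _ sxw)).
Qed.

Lemma supp_in_prod n (w : seq 'I_n) fs :
  all (supp_in w) fs -> supp_in w (\prod_(s <- fs) s).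
Proof.
elim: fs => [|s fs IHfs] /= => [_|/andP[/supp_inP sw /IHfs/supp_inP fw]].
  by apply/supp_inP => x _; rewrite big_nil perm1.
by apply/supp_inP => x xw; rewrite big_cons permM sw ?fw.
Qed.

Lemma supp_in_commute n (w1 w2 : seq 'I_n) s t :
  (forall x, x \in w1 -> x \notin w2) -> supp_in w1 s -> supp_in w2 t -> s * t = t * s.
Proof.
move=> dis s1 t2; apply/permP => x; rewrite !permM.
have [x1|x1] := boolP (x \in w1).
  by rewrite (supp_inP _ _ t2) ?dis ?supp_in_closed // (supp_inP _ _ t2) ?dis.
rewrite (supp_inP _ _ s1 x x1) (supp_inP _ _ s1) //.
have [x2|x2] := boolP (x \in w2); last by rewrite (supp_inP _ _ t2).
by apply/negP => /dis; rewrite supp_in_closed ?x2.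
Qed.

(** A cycle moves at least two letters. Neighbouring segments u a and a v share the letter a, and
    this is what still assigns each factor to only one of them. *)
Lemma cycle_supp_in2 n (w1 w2 : seq 'I_n) s :
  (forall x y, x \in w1 -> x \in w2 -> y \in w1 -> y \in w2 -> x = y) ->
  is_cycle_ge2 s -> supp_in w1 s -> ~~ supp_in w2 s.
Proof.
move=> meet1 /andP[ge2 _] s1; apply/negP => s2; move: ge2; rewrite ltnNge; case/negP.
have [->|[x xs]] := set_0Vmem (psupp s); first by rewrite cards0.
rewrite -(cards1 x); apply/subset_leq_card/subsetP => y ys; rewrite inE; apply/eqP.
by apply: meet1; [apply: (subsetP s1)|apply: (subsetP s2)|apply: (subsetP s1)|apply: (subsetP s2)].
Qed.

Lemma swap_step_sym n (fs gs : seq {perm 'I_n}) : swap_step fs gs -> swap_step gs fs.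
Proof. by case=> a [b [s [t [-> -> st]]]]; exists a, b, t, s. Qed.

(* Induction along chains of swaps, in the direct direction only. *)
Lemma fequiv_inv n (P : seq {perm 'I_n} -> Prop) :
  (forall fs gs, swap_step fs gs -> P fs -> P gs) ->
  forall fs gs, fequiv fs gs -> P fs -> P gs.
Proof.
move=> Pstep fs gs E; suff: P fs <-> P gs by case.
elim: E => {fs gs} // [fs gs E|fs gs _ [? ?]|fs gs hs _ [? ?] _ [? ?]].
- by split; apply: Pstep => //; apply: swap_step_sym.
- by split.
- by split; auto.
Qed.

Lemma fequiv_catl n (hs fs gs : seq {perm 'I_n}) :
  fequiv fs gs -> fequiv (hs ++ fs) (hs ++ gs).
Proof.
elim=> {fs gs} [fs|fs gs [a [b [s [t [-> -> st]]]]]|fs gs _ E|fs gs ks _ E1 _ E2].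
- exact: fequiv_refl.
- by apply: fequiv_step; exists (hs ++ a), b, s, t; rewrite !catA.
- exact: fequiv_sym.
- exact: fequiv_trans E2.
Qed.

Lemma fequiv_catr n (hs fs gs : seq {perm 'I_n}) :
  fequiv fs gs -> fequiv (fs ++ hs) (gs ++ hs).
Proof.
elim=> {fs gs} [fs|fs gs [a [b [s [t [-> -> st]]]]]|fs gs _ E|fs gs ks _ E1 _ E2].
- exact: fequiv_refl.
- by apply: fequiv_step; exists a, (b ++ hs), s, t; rewrite -!catA.
- exact: fequiv_sym.
- exact: fequiv_trans E2.
Qed.

Lemma fequiv_cat n (fs gs fs' gs' : seq {perm 'I_n}) :
  fequiv fs fs' -> fequiv gs gs' -> fequiv (fs ++ gs) (fs' ++ gs').
Proof. by move=> E1 E2; apply: (fequiv_trans (fequiv_catr _ E1)); apply: fequiv_catl. Qed.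

Lemma fequiv_swap n (fs gs : seq {perm 'I_n}) :
  (forall s t, s \in fs -> t \in gs -> s * t = t * s) -> fequiv (fs ++ gs) (gs ++ fs).
Proof.
elim: fs => [|s fs IHfs] com; first by rewrite cats0; exact: fequiv_refl.
apply: (@fequiv_trans _ _ (s :: gs ++ fs)).
  apply: (@fequiv_catl _ [:: s]); apply: IHfs => r t rfs.
  by apply: com; rewrite inE rfs orbT.
have {com} : forall t, t \in gs -> s * t = t * s by move=> t; apply: com; exact: mem_head.
elim: gs {IHfs} => [|t gs IHgs] com; first exact: fequiv_refl.
apply: (@fequiv_trans _ _ (t :: s :: gs ++ fs)).
  by apply: fequiv_step; exists [::], (gs ++ fs), s, t; split=> //; apply: com; exact: mem_head.
by apply: (@fequiv_catl _ [:: t]); apply: IHgs => r rgs; apply: com; rewrite inE rgs orbT.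
Qed.

Lemma fequiv_disjoint n (w1 w2 : seq 'I_n) fs gs :
  (forall x, x \in w1 -> x \notin w2) ->
  all (supp_in w1) fs -> all (supp_in w2) gs -> fequiv (fs ++ gs) (gs ++ fs).
Proof.
move=> dis /allP f1 /allP g2; apply: fequiv_swap => s t /f1 s1 /g2 t2.
exact: supp_in_commute s1 t2.
Qed.

(** A swap of two kept factors survives the filter; any other swap disappears. This carries an
    equivalence over to sub-factorizations. *)
Lemma fequiv_filter n (P : pred {perm 'I_n}) fs gs :
  fequiv fs gs -> fequiv (filter P fs) (filter P gs).
Proof.
elim=> {fs gs} [fs|fs gs [a [b [s [t [-> -> st]]]]]|fs gs _ E|fs gs ks _ E1 _ E2].
- exact: fequiv_refl.
- rewrite !filter_cat /=; case: ifP => Ps; case: ifP => Pt; try exact: fequiv_refl.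
  by apply: fequiv_step; exists (filter P a), (filter P b), s, t.
- exact: fequiv_sym.
- exact: fequiv_trans E2.
Qed.

Lemma fequiv_prod n (fs gs : seq {perm 'I_n}) :
  fequiv fs gs -> \prod_(s <- fs) s = \prod_(s <- gs) s.
Proof.
elim=> {fs gs} [//|fs gs [a [b [s [t [-> -> st]]]]]|//|fs gs ks _ -> _ -> //].
by rewrite !big_cat /= !big_cons !mulgA -(mulgA _ s) st !mulgA.
Qed.

Lemma fequiv_perm n (fs gs : seq {perm 'I_n}) : fequiv fs gs -> perm_eq fs gs.
Proof.
elim=> {fs gs} [//|fs gs [a [b [s [t [-> -> st]]]]]|fs gs _|fs gs ks _ E1 _].
- by rewrite perm_cat2l -(cat1s s) -(cat1s t) -(cat1s t (s :: b)) -(cat1s s b) perm_catCA.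
- by rewrite perm_sym.
- exact: perm_trans.
Qed.

Lemma fequiv_partition n (P : pred {perm 'I_n}) fs :
  (forall s t, s \in fs -> t \in fs -> P s -> ~~ P t -> s * t = t * s) ->
  fequiv fs (filter (predC P) fs ++ filter P fs).
Proof.
elim: fs => [|s fs IHfs] com; first exact: fequiv_refl.
have {}IHfs : fequiv fs (filter (predC P) fs ++ filter P fs).
  by apply: IHfs => r t rfs tfs; apply: com; rewrite inE ?rfs ?tfs orbT.
apply: (fequiv_trans (@fequiv_catl _ [:: s] _ _ IHfs)) => /=.
have [Ps|Ps] := boolP (P s) => /=; last exact: fequiv_refl.
rewrite -cat_cons -[s :: filter P fs]cat1s catA; apply: fequiv_catr.
apply: (@fequiv_swap _ [:: s]) => r t; rewrite inE => /eqP-> {r}.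
rewrite mem_filter => /andP[nPt tfs].
by apply: com => //; rewrite inE ?eqxx // tfs orbT.
Qed.

Lemma prod_fix_in n (w : seq 'I_n) (s t : {perm 'I_n}) : supp_in w s -> supp_in w t ->
  (forall x, x \in w -> s x = t x) -> s = t.
Proof.
move=> sw tw st; apply/permP => x; have [/st//|xw] := boolP (x \in w).
by rewrite (supp_inP _ _ sw) ?(supp_inP _ _ tw).
Qed.

Lemma wt_perm n (fs gs : seq {perm 'I_n}) : perm_eq fs gs -> wt fs = wt gs.
Proof. by move=> E; rewrite /wt; apply/perm_sumn/perm_map. Qed.

Lemma porbit_closed n (w : seq 'I_n) (s : {perm 'I_n}) x y :
  (forall z, (s z \in w) = (z \in w)) -> y \in porbit s x -> (y \in w) = (x \in w).
Proof.
move=> cl /porbitP[i ->]; elim: i => [|i IHi]; first by rewrite expg0 perm1.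
by rewrite expgSr permM cl.
Qed.

(** By [porbits_cyc2] the list is in the equality case of the orbit bound, so each factor keeps the
    orbits of the product, hence both words. A cycle starting in one word stays there; one starting
    outside both fixes its head, as the product does, and is the identity. *)
Lemma minimal_supp_in n (w1 w2 : seq 'I_n) fs s :
  w1 != [::] -> w2 != [::] -> uniq (w1 ++ w2) ->
  (forall s, s \in fs -> is_cyc s) ->
  \prod_(s <- fs) s = cyc w1 * cyc w2 ->
  wt fs = ((size w1).-1 + (size w2).-1)%N ->
  s \in fs -> supp_in w1 s || supp_in w2 s.
Proof.
move=> w1N w2N U cfs pE wE sfs; set c := cyc w1 * cyc w2 in pE.
have Es z : s z \in porbit c z.
  rewrite -pE; apply: porbits_prod_eq => //; rewrite pE /c wE.
  by have := porbits_cyc2 w1N w2N U; rlia.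
have dis x : x \in w1 -> x \notin w2 by move=> x1; cnt x.
have dis' x : x \in w2 -> x \notin w1 by move=> x2; cnt x.
have cl1 z : (c z \in w1) = (z \in w1).
  rewrite permM; have [z2|z2] := boolP (cyc w1 z \in w2); last first.
    by rewrite cyc_out // supp_in_closed // supp_in_cyc.
  have : cyc w2 (cyc w1 z) \in w2 by rewrite supp_in_closed ?supp_in_cyc.
  move/dis'/negbTE->; move/dis'/negbTE: z2; rewrite supp_in_closed ?supp_in_cyc //.
have cl2 z : (c z \in w2) = (z \in w2).
  rewrite permM supp_in_closed ?supp_in_cyc //.
  have [z1|z1] := boolP (z \in w1); last by rewrite cyc_out.
  by rewrite (negbTE (dis _ z1)); apply/negbTE/dis; rewrite supp_in_closed ?supp_in_cyc.
have [x [u [Ux sE]]] := cfs s sfs.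
have sub (w : seq 'I_n) y : (forall z, (c z \in w) = (z \in w)) -> x \in w -> y \in x :: u -> y \in w.
  move=> cl xw; rewrite -(porbit_cyc Ux (mem_head _ _)) -sE => yx.
  have cl' z : (s z \in w) = (z \in w) by exact: porbit_closed cl (Es z).
  by rewrite (porbit_closed cl' yx).
have [x1|x1] := boolP (x \in w1).
  by apply/orP; left; rewrite sE; apply: supp_inS (supp_in_cyc _) => y; exact: sub.
have [x2|x2] := boolP (x \in w2).
  by apply/orP; right; rewrite sE; apply: supp_inS (supp_in_cyc _) => y; exact: sub.
have sx : s x = x.
  have /porbitP[i ->] := Es x; elim: i => [|i IHi]; first by rewrite expg0 perm1.
  by rewrite expgSr permM IHi /c permM !cyc_out.
move: Ux sE sx; case: u {sub} => [|y u] Ux -> sx.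
  by apply/orP; left; apply/supp_inP => z _; rewrite cyc1 perm1.
by have := cyc_neq Ux isT (mem_head _ _); rewrite sx eqxx.
Qed.

(** The two groups commute because their supports are disjoint, and evaluating the product on each
    word identifies the partial products. The orbit bound gives a lower estimate for each weight,
    and the given total leaves no room above either. *)
Lemma split_minimal n (w1 w2 : seq 'I_n) fs (fs1 := filter (supp_in w1) fs)
    (fs2 := filter (predC (supp_in w1)) fs) :
  w1 != [::] -> w2 != [::] -> uniq (w1 ++ w2) ->
  (forall s, s \in fs -> is_cyc s) ->
  \prod_(s <- fs) s = cyc w1 * cyc w2 ->
  wt fs = ((size w1).-1 + (size w2).-1)%N ->
  [/\ fequiv fs (fs2 ++ fs1),
      \prod_(s <- fs1) s = cyc w1 /\ wt fs1 = (size w1).-1 &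
      \prod_(s <- fs2) s = cyc w2 /\ wt fs2 = (size w2).-1].
Proof.
move=> w1N w2N U cfs pE wE.
have supp12 s : s \in fs -> supp_in w1 s || supp_in w2 s.
  by move=> sfs; apply: minimal_supp_in pE wE sfs.
have dis x : x \in w1 -> x \notin w2 by move=> x1; cnt x.
have dis' x : x \in w2 -> x \notin w1 by move=> x2; cnt x.
have E : fequiv fs (fs2 ++ fs1).
  apply: fequiv_partition => s t sfs tfs s1 nt1; apply: (@supp_in_commute _ w1 w2) => //.
  by have := supp12 t tfs; rewrite (negbTE nt1).
have all1 : all (supp_in w1) fs1 by exact: filter_all.
have all2 : all (supp_in w2) fs2.
  by apply/allP => s; rewrite mem_filter => /andP[/= ns1 /supp12]; rewrite (negbTE ns1).
have [p1 p2] := (supp_in_prod all1, supp_in_prod all2).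
have pE' := fequiv_prod E; rewrite pE big_cat /= in pE'.
have pE1 : \prod_(s <- fs1) s = cyc w1.
  apply: prod_fix_in p1 (supp_in_cyc _) _ => x x1.
  have := congr1 (fun r : {perm 'I_n} => r x) pE'; rewrite !permM.
  rewrite (supp_inP _ _ p2) ?dis // => <-.
  by rewrite (cyc_out (w := w2)) // dis // supp_in_closed ?supp_in_cyc.
have pE2 : \prod_(s <- fs2) s = cyc w2.
  apply: (prod_fix_in p2 (supp_in_cyc _)) => x x2.
  have := congr1 (fun r : {perm 'I_n} => r x) pE'; rewrite !permM.
  rewrite (cyc_out (dis' _ x2)) => ->.
  by rewrite (supp_inP _ _ p1) // dis' // supp_in_closed.
have c1 s : s \in fs1 -> is_cyc s by rewrite mem_filter => /andP[_ /cfs].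
have c2 s : s \in fs2 -> is_cyc s by rewrite mem_filter => /andP[_ /cfs].
have [U1 U2] : uniq w1 /\ uniq w2 by split; ucnt.
have := porbits_prod c1; have := porbits_prod c2; rewrite pE1 pE2.
have := porbits_cyc w1N U1; have := porbits_cyc w2N U2.
have := wt_perm (fequiv_perm E); rewrite wt_cat wE => h1 h2 h3 h4 h5.
by split=> //; split=> //; move: h1 h2 h3 h4 h5; rlia.
Qed.

(** * The factorization attached to a labelled tree *)

(* In [srep w cs ts Bs As], cs lists the letters a_i, Bs the factors on the segments
   a_i v_i (applied before the cycle of the vertex) and As those on the u_i a_i
   (applied after it). *)
Inductive trep (n : nat) : seq 'I_n -> ptree -> seq {perm 'I_n} -> Prop :=
| trep_leaf x : trep [:: x] (PNode [::]) [::]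
| trep_node x v w cs t ts fs Bs As :
    trep (x :: v) t fs -> srep w cs ts Bs As -> cs != [::] ->
    trep (x :: v ++ w) (PNode (t :: ts)) (fs ++ Bs ++ cyc (x :: cs) :: As)
with srep (n : nat) : seq 'I_n -> seq 'I_n -> seq ptree ->
    seq {perm 'I_n} -> seq {perm 'I_n} -> Prop :=
| srep_nil : srep [::] [::] [::] [::] [::]
| srep_cons u a v w cs tA tB ts fA fB Bs As :
    trep (rcons u a) tA fA -> trep (a :: v) tB fB -> srep w cs ts Bs As ->
    srep (u ++ a :: v ++ w) (a :: cs) (tA :: tB :: ts) (fB ++ Bs) (fA ++ As).

Scheme trep_mind := Minimality for trep Sort Prop
  with srep_mind := Minimality for srep Sort Prop.
Combined Scheme trep_srep_ind from trep_mind, srep_mind.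

Lemma rep_supp n :
  (forall w t fs, @trep n w t fs -> all (supp_in w) fs) /\
  (forall w cs ts Bs As, @srep n w cs ts Bs As ->
     [/\ {subset cs <= w}, all (supp_in w) Bs & all (supp_in w) As]).
Proof.
apply: trep_srep_ind => //= [x v w cs t ts fs Bs As _ IHt _ [cw IHB IHA] _|
    u a v w cs tA tB ts fA fB Bs As _ IHA _ IHB _ [cw IHBs IHAs]].
- rewrite !all_cat /= (all_supp_inS _ IHt); last by move=> z; rewrite -cat_cons mem_cat => ->.
  have sw : {subset w <= x :: v ++ w} by move=> z zw; rewrite -cat_cons mem_cat zw orbT.
  rewrite (all_supp_inS sw IHB) (all_supp_inS sw IHA) /= andbT; apply: supp_inS (supp_in_cyc _) => z.
  by rewrite inE => /predU1P[->|/cw/sw]; rewrite ?mem_head.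
- rewrite !all_cat; have sw : {subset w <= u ++ a :: v ++ w}.
    by move=> z zw; cnt z.
  rewrite (all_supp_inS sw IHBs) (all_supp_inS sw IHAs) !andbT; split.
  + by move=> z; rewrite inE => /predU1P[->|/cw/sw]; rewrite // mem_cat mem_head orbT.
  + by apply: all_supp_inS IHB => z zB; cnt z.
  + by apply: all_supp_inS IHA => z zA; cnt z.
Qed.

Definition trep_supp n := (rep_supp n).1.
Definition srep_supp n := (rep_supp n).2.

Lemma srep_cs_subseq n (w cs : seq 'I_n) ts Bs As :
  srep w cs ts Bs As -> subseq cs w.
Proof.
elim=> {w cs ts Bs As} // u a v w cs tA tB ts fA fB Bs As _ _ _ IH.
by rewrite -cat1s -[a :: v ++ w]cat1s catA; apply: cat_subseq;
  [exact: suffix_subseq|apply: subseq_trans IH (suffix_subseq _ _)].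
Qed.

(** The vertex cycle contains the head x, which is not a letter of w; the second claim therefore
    carries x along and places the cycle between [Bs] and [As]. *)
Lemma rep_prod n :
  (forall w t fs, @trep n w t fs -> uniq w -> \prod_(s <- fs) s = cyc w) /\
  (forall w cs ts Bs As, @srep n w cs ts Bs As -> uniq w -> forall x, x \notin w ->
     \prod_(s <- Bs) s * (cyc (x :: cs) * \prod_(s <- As) s) = cyc (x :: w)).
Proof.
apply: trep_srep_ind => [x|x v w cs t ts fs Bs As _ IHt _ IHs _ U||
    u a v w cs tA tB ts fA fB Bs As _ IHA tBr IHB sr IHs U x xw].
- by rewrite big_nil cyc1.
- rewrite cyc_cat -IHt; last by ucnt.
  by rewrite -(IHs _ x); [rewrite !big_cat big_cons|ucnt|cnt x].
- by move=> _ x _; rewrite !big_nil mulg1 mul1g.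
have [sub sB sA] := srep_supp sr.
have [U1 U2 U3] : [/\ uniq (rcons u a), uniq (a :: v) & uniq w] by split; ucnt.
have U4 : uniq (a :: u) by ucnt.
have xw' : x \notin w by cnt x.
have Ux : uniq (x :: u ++ a :: v ++ w) by rewrite cons_uniq xw.
have Uc : uniq (x :: cs) by have := subseq_uniq (srep_cs_subseq sr) U3; rewrite /= => ->; rewrite andbT; apply: contra xw' => /sub.
rewrite !big_cat /= IHA // IHB // cyc_rot1 // cyc_cons.
set PB := \prod_(s <- Bs) s; set PA := \prod_(s <- As) s; set C := cyc (x :: cs).
have cPB : PB * tperm x a = tperm x a * PB.
  apply: (@supp_in_commute _ w [:: x; a]).
  - by move=> z zw; cnt z.
  - exact: supp_in_prod.
  - by have := supp_in_cyc [:: x; a]; rewrite cyc_cons cyc1 mulg1.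
have cC : PB * C * cyc (a :: u) = cyc (a :: u) * (PB * C).
  apply: (@supp_in_commute _ (x :: w) (a :: u)).
  - by move=> z zw; cnt z.
  - have -> : PB * C = \prod_(s <- rcons Bs C) s by rewrite -cats1 big_cat big_seq1.
    apply: supp_in_prod; rewrite all_rcons; apply/andP; split.
      by apply: supp_inS (supp_in_cyc _) => z; rewrite !inE => /predU1P[->|/sub ->]; rewrite ?eqxx ?orbT.
    by apply: all_supp_inS sB => z zw; rewrite inE zw orbT.
  - exact: supp_in_cyc.
(* The factors on u a v are gathered in front with [tperm x a], where they form the cycle of x u a
   v; what remains is the induction hypothesis. *)
have -> : cyc (a :: v) * PB * (tperm x a * C * (cyc (a :: u) * PA)) =
    (cyc (a :: v) * tperm x a * cyc (a :: u)) * (PB * (C * PA)).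
  by rewrite -!mulgA; congr (_ * _); rewrite !mulgA cPB -!mulgA;
    congr (_ * _); rewrite !mulgA cC !mulgA.
rewrite (IHs U3 x xw') (_ : x :: u ++ a :: v ++ w = x :: (u ++ a :: v) ++ w); last by rewrite -catA.
rewrite (cyc_cat x (u ++ a :: v)); congr (_ * _).
have -> : tperm x a = cyc [:: a; x] by rewrite cyc_cons cyc1 mulg1 tpermC.
rewrite -!cyc_cat -catA; apply: (@cyc_rot n (x :: u) (a :: v)); ucnt.
Qed.

Lemma rep_wt n :
  (forall w t fs, @trep n w t fs -> uniq w -> wt fs = (size w).-1) /\
  (forall w cs ts Bs As, @srep n w cs ts Bs As -> uniq w ->
     (wt Bs + wt As + size cs)%N = size w).
Proof.
apply: trep_srep_ind => // [x v w cs t ts fs Bs As _ IHt sr IHs _ U|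
    u a v w cs tA tB ts fA fB Bs As _ IHA _ IHB _ IHs U].
- have [U1 U2] : uniq (x :: v) /\ uniq w by split; ucnt.
  have [sub _ _] := srep_supp sr.
  have Uc : uniq (x :: cs).
    rewrite /= (subseq_uniq (srep_cs_subseq sr) U2) andbT.
    by apply/negP => /sub xw; cnt x.
  have := IHt U1; have := IHs U2.
  rewrite !wt_cat /= size_cat => h1 ->; rewrite {2}/wt /= -/(wt As) cyc_len_pred //=; lia.
- have [U1 U2 U3] : [/\ uniq (rcons u a), uniq (a :: v) & uniq w] by split; ucnt.
  have := IHA U1; have := IHB U2; have := IHs U3.
  rewrite !wt_cat !size_cat size_rcons /= size_cat; lia.
Qed.

Lemma rep_cycles n :
  (forall w t fs, @trep n w t fs -> uniq w -> all (@is_cycle_ge2 n) fs) /\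
  (forall w cs ts Bs As, @srep n w cs ts Bs As -> uniq w ->
     all (@is_cycle_ge2 n) Bs && all (@is_cycle_ge2 n) As).
Proof.
apply: trep_srep_ind => // [x v w cs t ts fs Bs As _ IHt sr IHs csN U|
    u a v w cs tA tB ts fA fB Bs As _ IHA _ IHB _ IHs U].
- have [U1 U2] : uniq (x :: v) /\ uniq w by split; ucnt.
  have [sub _ _] := srep_supp sr.
  have Uc : uniq (x :: cs).
    rewrite /= (subseq_uniq (srep_cs_subseq sr) U2) andbT.
    by apply/negP => /sub xw; cnt x.
  have /andP[hB hA] := IHs U2; rewrite !all_cat (IHt U1) hB /= hA andbT.
  by apply: is_cycle_cyc => //; case: (cs) csN.
- have [U1 U2 U3] : [/\ uniq (rcons u a), uniq (a :: v) & uniq w] by split; ucnt.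
  have /andP[bs as'] := IHs U3.
  by rewrite !all_cat IHA // IHB // bs as'.
Qed.

(** A cycle of k + 1 letters belongs to a vertex with 2k + 1 children and a parent edge. The 2k
    segments of w have total length |w| + k, each a_i being in two of them, so their leaves number
    2(|w| + k) - 2k. With [P] arbitrary, all degree conditions follow from one count. *)
Lemma rep_cnt n (P : pred nat) :
  (forall w t fs, @trep n w t fs -> uniq w ->
     cnt_nonroot P t = (P 1 * (2 * size w).-1 + count (fun s => P (2 * cyc_len s)) fs)%N) /\
  (forall w cs ts Bs As, @srep n w cs ts Bs As -> uniq w ->
     size ts = (2 * size cs)%N /\
     sumn (map (cnt_nonroot P) ts) =
     (P 1 * (2 * size w) + count (fun s => P (2 * cyc_len s)) (Bs ++ As))%N).
Proof.
apply: trep_srep_ind => // [x|x v w cs t ts fs Bs As _ IHt sr IHs csN U|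
    |u a v w cs tA tB ts fA fB Bs As _ IHA _ IHB _ IHs U].
- by rewrite /=; lia.
- have [U1 U2] : uniq (x :: v) /\ uniq w by split; ucnt.
  have [sub _ _] := srep_supp sr.
  have Uc : uniq (x :: cs).
    rewrite /= (subseq_uniq (srep_cs_subseq sr) U2) andbT.
    by apply/negP => /sub xw; cnt x.
  have [tsE cE] := IHs U2.
  rewrite /= IHt // tsE cE !count_cat /= cyc_len_cyc //; last by case: (cs) csN.
  rewrite /= size_cat (_ : (2 * size cs).+2 = 2 * (size cs).+1)%N; last by lia.
  by case: (P 1%N) => /=; lia.
- by rewrite /=; split=> //; lia.
- have [U1 U2 U3] : [/\ uniq (rcons u a), uniq (a :: v) & uniq w] by split; ucnt.
  have [tsE cE] := IHs U3; split; first by rewrite /= tsE; lia.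
  rewrite /= IHA // IHB // cE !count_cat !size_cat size_rcons /= size_cat.
  by case: (P 1%N) => /=; lia.
Qed.

(** * Every minimal factorization comes from a tree *)

Lemma cat_split (T : Type) (l r p q : seq T) x : l ++ r = p ++ x :: q ->
  (exists2 q1, l = p ++ x :: q1 & q = q1 ++ r) \/
  (exists2 p1, p = l ++ p1 & r = p1 ++ x :: q).
Proof.
elim: l p => [|y l IHl] p /=; first by move=> ->; right; exists p.
case: p => [|z p] /= [<-] => [<-|/IHl[[q1 -> ->]|[p1 -> ->]]].
- by left; exists l.
- by left; exists q1.
- by right; exists p1.
Qed.

(** Inserting behind a letter keeps the head of the word, so the enlarged word still has the shape
    that the constructors ask for. *)
Lemma insert_head (T : Type) (p q r v : seq T) x a :
  a :: r = p ++ x :: q -> exists r', p ++ x :: v ++ q = a :: r'.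
Proof. by case: p => [|y p] /= [<- _]; [exists (v ++ q)|exists (p ++ x :: v ++ q)]. Qed.

(* The leaf at which b is the first letter is replaced by a node whose cycle
   (b :: bs) is applied before all the other factors. *)
Lemma rep_insert n (b : 'I_n) v bs ts1 As1 (X := cyc (b :: bs) :: As1) :
  srep v bs ts1 [::] As1 -> bs != [::] ->
  (forall w t fs, trep w t fs -> forall p q, w = p ++ b :: q ->
     uniq (p ++ b :: v ++ q) ->
     exists t' fs', trep (p ++ b :: v ++ q) t' fs' /\ fequiv (X ++ fs) fs') /\
  (forall w cs ts Bs As, srep w cs ts Bs As -> forall p q, w = p ++ b :: q ->
     uniq (p ++ b :: v ++ q) ->
     exists ts' Bs' As', srep (p ++ b :: v ++ q) cs ts' Bs' As' /\
     forall (z : seq 'I_n) s, (forall y, y \in z -> y \notin p ++ b :: v ++ q) ->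
       supp_in (z ++ cs) s -> fequiv (X ++ Bs ++ s :: As) (Bs' ++ s :: As')).
Proof.
move=> sv bsN; have [subv _ sA1] := srep_supp sv.
have sX : all (supp_in (b :: v)) X.
  rewrite /= (all_supp_inS _ sA1) => [|z zv]; last by rewrite inE zv orbT.
  rewrite andbT; apply: supp_inS (supp_in_cyc _) => z; rewrite !inE => /predU1P[->|/subv->].
    by rewrite eqxx.
  by rewrite orbT.
(* In the claim on [srep], s stands for the cycle of the vertex and z for its letters outside the
   word: the head and, as the recursion advances, the a_i already passed. *)
apply: trep_srep_ind => //.
- move=> x [|y [|? ?]] // q [_ <-] _.
  exists (PNode (PNode [::] :: ts1)), ([::] ++ [::] ++ cyc (b :: bs) :: As1).
  by split; [rewrite cats0; exact: (trep_node (trep_leaf b) sv bsN)|rewrite cats0 /=; exact: fequiv_refl].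
- move=> x v0 w cs t ts fs Bs As tr IHt sr IHs csN p q.
  rewrite -cat_cons => /(@cat_split 'I_n (x :: v0))[[q1 E ->]|[p1 -> E]] U.
    have [|t' [fs' [tr' eq']]] := IHt p q1 E; first by ucnt.
    have [v' Ev] := insert_head v E.
    exists (PNode (t' :: ts)), (fs' ++ Bs ++ cyc (x :: cs) :: As).
    split; last by rewrite catA; apply: fequiv_catr.
    have -> : p ++ b :: v ++ q1 ++ w = x :: v' ++ w.
      by rewrite -[x :: v' ++ w]cat_cons -Ev -!catA /= -catA.
    by rewrite Ev in tr'; exact: (trep_node tr' sr csN).
  have [|ts' [Bs' [As' [sr' eq']]]] := IHs p1 q E; first by ucnt.
  exists (PNode (t :: ts')), (fs ++ Bs' ++ cyc (x :: cs) :: As').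
  split; first by rewrite -catA; exact: (trep_node tr sr' csN).
  have [sub _ _] := srep_supp sr; have sf := trep_supp tr.
  apply: (@fequiv_trans _ _ (fs ++ X ++ Bs ++ cyc (x :: cs) :: As)).
    rewrite (catA X fs) (catA fs X); apply: fequiv_catr.
    by apply: (fequiv_disjoint _ sX sf) => y yb; cnt y.
  apply: fequiv_catl; apply: (eq' [:: x]); last exact: supp_in_cyc.
  by move=> y; rewrite inE => /eqP->; cnt x.
- by move=> p q; case: p.
move=> u a v0 w cs tA tB ts fA fB Bs As trA IHA trB IHB sr IHs p q.
have [sub sB sA] := srep_supp sr; have [sfA sfB] := (trep_supp trA, trep_supp trB).
case/(@cat_split 'I_n u)=> [[q1 uE ->]|[p1 -> /(@cat_split 'I_n (a :: v0))[[q1 E ->]|[p2 -> E]]]] U.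
(* Here b lies in u, so the new factors are disjoint from [fB], [Bs] and s; they move past all of
   these and join [fA]. *)
- have [||tA' [fA' [trA' eqA]]] := IHA p (rcons q1 a); first by rewrite uE rcons_cat.
    by ucnt.
  exists (tA' :: tB :: ts), (fB ++ Bs), (fA' ++ As); split.
    have -> : p ++ b :: v ++ q1 ++ a :: v0 ++ w = (p ++ b :: v ++ q1) ++ a :: v0 ++ w.
      by rewrite -!catA /= -!catA.
    apply: (srep_cons _ trB sr); move: trA'.
    by rewrite rcons_cat rcons_cons rcons_cat.
  move=> z s zP ss; set M := fB ++ Bs.
  apply: (@fequiv_trans _ _ ((M ++ [:: s]) ++ X ++ fA ++ As)).
    rewrite (_ : X ++ M ++ s :: fA ++ As = (X ++ (M ++ [:: s])) ++ fA ++ As); last by rewrite -!catA.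
    rewrite (catA (M ++ _)); apply: fequiv_catr.
    apply: (@fequiv_disjoint _ (b :: v) ((a :: v0) ++ w ++ z)) => //.
      move=> y yb; have yz : y \notin z by apply/negP => /zP; rewrite mem_mult; cnt y.
      by cnt y.
    rewrite !all_cat /= andbT (all_supp_inS _ sfB) => [|y yv]; last by cnt y.
    rewrite (all_supp_inS _ sB) => [|y yv]; last by cnt y.
    apply: supp_inS ss => y; rewrite mem_cat inE => /or3P[yz|/eqP->|/sub yw].
    + by cnt y.
    + by cnt a.
    + by cnt y.
  rewrite -catA; apply: fequiv_catl; apply: (@fequiv_catl _ [:: s]).
  by rewrite catA; apply: fequiv_catr.
(* Here b lies in a v, possibly b = a. The leaf grown is in the segment that begins with a, whose
   factors already stand in front. *)
- have [|tB' [fB' [trB' eqB]]] := IHB p1 q1 E; first by ucnt.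
  have [v' Ev] := insert_head v E.
  exists (tA :: tB' :: ts), (fB' ++ Bs), (fA ++ As); split.
    have -> : (u ++ p1) ++ b :: v ++ q1 ++ w = u ++ a :: v' ++ w.
      by rewrite -[a :: v' ++ w]cat_cons -Ev -!catA /= -!catA.
    by rewrite Ev in trB'; exact: (srep_cons trA trB' sr).
  by move=> z s _ _; rewrite -!catA catA; apply: fequiv_catr.
(* Here b lies in w. The factors [fB] and [fA] are disjoint from everything the induction hypothesis
   rearranges and are moved out of its way. *)
- have [|ts' [Bs' [As' [sr' eq']]]] := IHs p2 q E; first by ucnt.
  have [_ _ sA'] := srep_supp sr'.
  exists (tA :: tB :: ts'), (fB ++ Bs'), (fA ++ As'); split.
    by rewrite -[_ ++ p2]/(a :: v0 ++ p2) -catA /= -catA; exact: (srep_cons trA trB sr').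
  move=> z s zP ss.
  apply: (@fequiv_trans _ _ (fB ++ (X ++ Bs ++ s :: As) ++ fA)).
    apply: (@fequiv_trans _ _ (fB ++ X ++ Bs ++ s :: fA ++ As)).
      rewrite -(catA fB Bs) (catA X fB) (catA fB X); apply: fequiv_catr.
      by apply: (fequiv_disjoint _ sX sfB) => y yb; cnt y.
    apply: fequiv_catl; rewrite -catA; apply: fequiv_catl.
    rewrite -catA; apply: fequiv_catl; apply: (@fequiv_catl _ [:: s]).
    by apply: (fequiv_disjoint _ sfA sA) => y yu; rewrite E; cnt y.
  rewrite -(catA fB Bs'); apply: fequiv_catl.
  apply: (@fequiv_trans _ _ ((Bs' ++ s :: As') ++ fA)).
    apply: fequiv_catr; apply: (eq' (rcons z a)); last by rewrite cat_rcons.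
    move=> y; rewrite mem_rcons inE => /predU1P[->|yz]; first by cnt a.
    by have := zP y yz; rewrite !mem_mult; cnt y.
  rewrite -catA; apply: fequiv_catl; apply: (@fequiv_catl _ [:: s]).
  by apply: fequiv_sym; apply: (fequiv_disjoint _ sfA sA') => y yu; cnt y.
Qed.

Definition mfact (n : nat) (w : seq 'I_n) (fs : seq {perm 'I_n}) : Prop :=
  [/\ all (@is_cycle_ge2 n) fs, \prod_(s <- fs) s = cyc w & wt fs = (size w).-1].

Lemma wt_cons n (w : seq 'I_n) fs : uniq w -> wt (cyc w :: fs) = ((size w).-1 + wt fs)%N.
Proof. by move=> U; rewrite /wt /= cyc_len_pred. Qed.

(** Conjugation by [tperm b c] turns [cyc (b :: u)] into [cyc (c :: u)], which is a rotation of u c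
    and disjoint from b v. *)
Lemma cyc_peel n (b c : 'I_n) u v : uniq (b :: u ++ c :: v) ->
  tperm b c * cyc (b :: u ++ c :: v) = cyc (b :: v) * cyc (rcons u c).
Proof.
move=> U; rewrite cyc_cat cyc_cons.
have bu : b \notin u by cnt b.
have cu : c \notin u by cnt c.
have U' : uniq (c :: u) by ucnt.
have J : tperm b c * cyc (b :: u) * tperm b c = cyc (c :: u).
  have := cycJ (b :: u) (tperm b c); rewrite conjgE tpermV mulgA => ->.
  by rewrite /= tpermL map_tperm.
rewrite cyc_rot1 // !mulgA J.
apply: (@supp_in_commute _ (c :: u) (b :: v)); try exact: supp_in_cyc.
by move=> z zu; cnt z.
Qed.

(** Induction on [bs] cuts off one disjoint cycle at a time. Each letter c closes a segment u c,
    whose factors act after the peeled cycle and form a tree by [IH]; the segment starting at c is a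
    bare leaf, since nothing acts before the first factor. [gs0] is what remains on b v2. The clause
    on [last] records that v1 ends where [bs] does. *)
Lemma arcs n k :
  (forall fs (w : seq 'I_n), (size fs <= k)%N -> uniq w -> w != [::] -> mfact w fs ->
     exists t fs', trep w t fs' /\ fequiv fs fs') ->
  forall bs b v gs, (size gs <= k)%N -> uniq (b :: bs) -> uniq (b :: v) ->
    all (@is_cycle_ge2 n) gs -> cyc (b :: bs) * \prod_(s <- gs) s = cyc (b :: v) ->
    (size bs + wt gs)%N = size v ->
  exists v1 v2 ts As gs0,
    [/\ v = v1 ++ v2, srep v1 bs ts [::] As, fequiv gs (As ++ gs0),
        (forall z, last z v1 = last z bs) &
        mfact (b :: v2) gs0 /\ (size gs0 <= size gs)%N].
Proof.
move=> IH; elim=> [|c bs IHbs] b v gs gsk Ub Uv cgs pE wE.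
  exists [::], v, [::], [::], gs; split=> //; [exact: srep_nil|exact: fequiv_refl|].
  by rewrite cyc1 mul1g in pE.
have cyc_gs s : s \in gs -> is_cyc s by move=> sgs; apply/is_cycle_is_cyc/(allP cgs).
have Ubs : uniq (b :: bs) by ucnt.
(* The peeled cycle sends b to c, and in the equality case it keeps the orbits of the product, one
   of which is b v. *)
have cv : c \in v.
  have /(_ b) := @porbits_prod_eq n (cyc [:: b, c & bs] :: gs) (cyc [:: b, c & bs]).
  rewrite big_cons pE cyc_head // porbit_cyc ?mem_head // inE => H.
  have /orP[/eqP bc|//] : (c == b) || (c \in v).
    apply: H => //.
    - by move=> s; rewrite inE => /predU1P[->|/cyc_gs //]; exists b, (c :: bs).
    - by rewrite wt_cons //; have := @porbits_cyc n (b :: v) isT Uv; move: wE; rlia.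
  by rewrite bc in Ub; exfalso; cnt b.
case/splitPr: cv Uv pE wE => u v' Uv pE wE.
have cN : rcons u c != [::] by case: (u).
have U12 : uniq ((b :: v') ++ rcons u c) by ucnt.
have pE' : \prod_(s <- cyc (b :: bs) :: gs) s = cyc (b :: v') * cyc (rcons u c).
  by rewrite big_cons -cyc_peel // -pE cyc_cons -!mulgA tpermKg.
have wE' : wt (cyc (b :: bs) :: gs) = ((size (b :: v')).-1 + (size (rcons u c)).-1)%N.
  by rewrite wt_cons // size_rcons; move: wE; rewrite size_cat /=; clear; lia.
have cL s : s \in cyc (b :: bs) :: gs -> is_cyc s.
  by rewrite inE => /predU1P[->|/cyc_gs //]; exists b, bs.
have supp12 s : s \in cyc (b :: bs) :: gs -> supp_in (b :: v') s || supp_in (rcons u c) s.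
  exact: minimal_supp_in pE' wE'.
(* The shortened cycle starts at b, so it belongs to the b v' side and stays with [gs1] for the
   induction. *)
have head1 : supp_in (b :: v') (cyc (b :: bs)).
  case/orP: (supp12 _ (mem_head _ _)) => // h2.
  case: (bs) Ubs h2 => [|d bs'] Ubs h2; first by apply/supp_inP => z _; rewrite cyc1 perm1.
  have /(supp_inP _ _ h2) : b \notin rcons u c by cnt b.
  by move/eqP; rewrite (negbTE (cyc_neq Ubs isT (mem_head _ _))).
have [_] := @split_minimal n (b :: v') _ _ isT cN U12 cL pE' wE'.
rewrite /= head1 /= big_cons wt_cons //.
set gs1 := filter (supp_in (b :: v')) gs; set gs2 := filter _ gs => -[pE1 wE1] [pE2 wE2].
have Egs : fequiv gs (gs2 ++ gs1).
  apply: fequiv_partition => s t sfs tfs s1 nt1.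
  apply: (@supp_in_commute _ (b :: v') (rcons u c)) => // [x xv|]; first by cnt x.
  by have := supp12 t (@mem_behead _ (_ :: gs) t tfs); rewrite (negbTE nt1).
have sz1 : (size gs1 <= size gs)%N by rewrite size_filter count_size.
have sz2 : (size gs2 <= size gs)%N by rewrite size_filter count_size.
have call P : all (@is_cycle_ge2 n) (filter P gs).
  by apply/allP => s; rewrite mem_filter => /andP[_ /(allP cgs)].
have Uv' : uniq (b :: v') by ucnt.
have Uc : uniq (rcons u c) by ucnt.
have [v1 [v2 [ts [As [gs0 [vE sr E1 lastE [mf sz0]]]]]]] :=
  IHbs b v' gs1 (leq_trans sz1 gsk) Ubs Uv' (call _) pE1 wE1.
have [tA [fA [trA EA]]] :=
  IH gs2 _ (leq_trans sz2 gsk) Uc cN (And3 (call _) pE2 wE2).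
exists (u ++ c :: [::] ++ v1), v2, (tA :: PNode [::] :: ts), (fA ++ As), gs0; split.
- by rewrite vE -catA.
- exact: (srep_cons trA (trep_leaf c) sr).
- by apply: (fequiv_trans Egs); rewrite -catA; apply: fequiv_cat.
- by move=> z; rewrite last_cat /= lastE.
- by split=> //; apply: leq_trans sz0 sz1.
Qed.

Lemma split_first (T : Type) (P : pred T) w : has P w ->
  exists p b q, [/\ w = p ++ b :: q, P b & all (predC P) p].
Proof.
elim: w => //= x w IHw; have [Px _|nPx /= /IHw[p [b [q [-> Pb nPp]]]]] := boolP (P x).
  by exists [::], x, w.
by exists (x :: p), b, q; rewrite /= nPx.
Qed.

(** Induction on the number of factors. Taking for b the first letter of w that s moves keeps the
    segments v1 inside q after the rotation to b q p. Removing v1 leaves the word p b q', factored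
    by [gs0], and its tree is grown at b by [rep_insert]. *)
Lemma trep_surj n (w : seq 'I_n) fs : uniq w -> w != [::] -> mfact w fs ->
  exists t fs', trep w t fs' /\ fequiv fs fs'.
Proof.
have [k] := ubnP (size fs); elim: k fs w => // k IH [|s gs] w; rewrite ltnS => szk U wN [].
  move=> _ _; case: w U wN => [|x [|//]] //= _ _ _.
  by exists (PNode [::]), [::]; split; [exact: trep_leaf|exact: fequiv_refl].
move=> /= /andP[cs cgs] pE wE.
have cL r : r \in s :: gs -> is_cyc r.
  by rewrite inE => /predU1P[->|/(allP cgs)]; apply: is_cycle_is_cyc.
have sw : supp_in w s.
  apply/supp_inP => z zw; apply/eqP; rewrite -(porbit_cyc_out _ zw) -pE.
  apply: porbits_prod_eq (mem_head _ _) => //; rewrite pE wE.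
  by have := porbits_cyc wN U; rlia.
have [b0 [U0 sz0 sE]] := is_cycle_cycP cs.
have : has (fun z => s z != z) w.
  case: (b0) U0 sz0 sE => [|x u] // U0 sz0 sE; apply/hasP; exists x.
    by apply: contraT => /(supp_inP _ _ sw)/eqP; rewrite sE (negbTE (cyc_neq U0 sz0 (mem_head _ _))).
  by rewrite sE cyc_neq ?mem_head.
case/split_first=> p [b [q [wE' sb sp]]].
have bb0 : b \in b0 by apply: contraR sb => bb0; rewrite sE cyc_out.
case/splitPr: bb0 U0 sz0 sE => l r U0 sz0 sE.
have [bs [Ub bsN sE']] : exists bs, [/\ uniq (b :: bs), bs != [::] & s = cyc (b :: bs)].
  have Ur : uniq (b :: r ++ l) by ucnt.
  exists (r ++ l); split=> //; last by rewrite sE -cat_cons cyc_rot.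
  by rewrite -size_eq0; move: sz0; rewrite !size_cat /=; clear; lia.
have Uv : uniq (b :: q ++ p) by rewrite wE' in U; ucnt.
rewrite big_cons in pE.
have IHk fs (w' : seq 'I_n) : (size fs <= size gs)%N -> uniq w' -> w' != [::] ->
    mfact w' fs -> exists t fs', trep w' t fs' /\ fequiv fs fs'.
  by move=> szf; apply: IH; apply: leq_ltn_trans szf szk.
have pE3 : cyc (b :: bs) * \prod_(r <- gs) r = cyc (b :: q ++ p).
  by rewrite -sE' pE wE' -cyc_rot // -wE'.
have wE3 : (size bs + wt gs)%N = size (q ++ p).
  by move: wE; rewrite sE' wt_cons // wE' !size_cat /=; clear; lia.
have [v1 [v2 [ts [As [gs0 [vE sr E1 lastE [[c0 p0 w0] sz]]]]]]] :=
  arcs IHk (leqnn _) Ub Uv cgs pE3 wE3.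
(* The last letter of v1 is in [bs], hence moved by s, whereas s fixes every letter of p. *)
have [q' qE v2E] : exists2 q', q = v1 ++ q' & v2 = q' ++ p.
  case/lastP: v1 vE sr lastE => [|v1 c] vE sr lastE.
    have := srep_cs_subseq sr; by rewrite subseq0 (negbTE bsN).
  have cbs : c \in bs.
    by have := lastE b; rewrite last_rcons => ->; case: (bs) bsN => // ? ? _; rewrite /= mem_last.
  rewrite cat_rcons in vE; case/(@cat_split 'I_n q): vE => [[q1 -> ->]|[p1 _ pE2]].
    by exists q1; rewrite // cat_rcons.
  have : c \in p by rewrite pE2 mem_cat mem_head orbT.
  by move/(allP sp); rewrite /= sE' cyc_neq //= ?inE ?cbs ?orbT //; case: (bs) bsN.
have U1 : uniq (p ++ b :: v1 ++ q') by rewrite qE in Uv; ucnt.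
have U2 : uniq (p ++ b :: q') by ucnt.
have wN' : p ++ b :: q' != [::] by case: (p).
have m0 : mfact (p ++ b :: q') gs0.
  split=> //; first by rewrite p0 v2E -cat_cons cyc_rot.
  by rewrite w0 v2E /= !size_cat /=; clear; lia.
have [t0 [fs0 [tr0 E0]]] := IHk gs0 _ sz U2 wN' m0.
have [t' [fs' [tr' E']]] := (rep_insert b sr bsN).1 _ _ _ tr0 p q' erefl U1.
exists t', fs'; split; first by rewrite wE' qE.
apply: fequiv_trans E'; rewrite /= -sE'; apply: (@fequiv_catl _ [:: s]).
by apply: (fequiv_trans E1); apply: fequiv_catl.
Qed.

(** * The tree is determined by the commutation class *)

Lemma trep_inv n (w : seq 'I_n) t fs : trep w t fs ->
  match children t with
  | [::] => fs = [::] /\ exists x, w = [:: x]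
  | t0 :: ts => exists x v w1 cs f Bs As,
      [/\ w = x :: v ++ w1, fs = f ++ Bs ++ cyc (x :: cs) :: As, trep (x :: v) t0 f,
          srep w1 cs ts Bs As & cs != [::]]
  end.
Proof.
case=> [x|x v w1 cs t0 ts f Bs As tr sr csN] /=; first by split=> //; exists x.
by exists x, v, w1, cs, f, Bs, As.
Qed.

Lemma srep_inv n (w cs : seq 'I_n) ts Bs As : srep w cs ts Bs As ->
  (w = [::] /\ [/\ cs = [::], ts = [::], Bs = [::] & As = [::]]) \/
  exists u a v w1 cs1 tA tB ts1 fA fB, exists Bs1 As1,
    [/\ w = u ++ a :: v ++ w1, cs = a :: cs1, ts = tA :: tB :: ts1,
        Bs = fB ++ Bs1 /\ As = fA ++ As1 &
        [/\ trep (rcons u a) tA fA, trep (a :: v) tB fB & srep w1 cs1 ts1 Bs1 As1]].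
Proof.
case=> [|u a v w1 cs1 tA tB ts1 fA fB Bs1 As1 trA trB sr]; first by left.
by right; exists u, a, v, w1, cs1, tA, tB, ts1, fA, fB, Bs1, As1.
Qed.

(** The tree has 2m - 1 leaves for a word of length m; no factor contributes, since twice a length
    is never 1. *)
Lemma trep_size n (w w' : seq 'I_n) t fs fs' : uniq w -> uniq w' ->
  trep w t fs -> trep w' t fs' -> size w = size w'.
Proof.
move=> U U' tr tr'; have := (rep_cnt n (pred1 1%N)).1 _ _ _ tr' U'.
rewrite ((rep_cnt n (pred1 1%N)).1 _ _ _ tr U).
have c0 (gs : seq {perm 'I_n}) : count (fun s => pred1 1%N (2 * cyc_len s)%N) gs = 0.
  by rewrite (eq_count (a2 := pred0)) ?count_pred0 // => s /=; apply/negbTE; lia.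
by rewrite !c0 /=; clear; lia.
Qed.

(** Each child fixes the length of its segment by [trep_size], so the tree prescribes every cut of
    the word. *)
Lemma rep_det n :
  (forall (w : seq 'I_n) t fs, trep w t fs -> uniq w -> forall fs', trep w t fs' -> fs = fs') /\
  (forall (w cs : seq 'I_n) ts Bs As, srep w cs ts Bs As -> uniq w ->
     forall cs' Bs' As', srep w cs' ts Bs' As' -> [/\ cs = cs', Bs = Bs' & As = As']).
Proof.
apply: trep_srep_ind.
- by move=> x _ fs' /trep_inv[->].
- move=> x v w cs t ts fs Bs As tr IHt _ IHs _ U fs'.
  case/trep_inv=> x' [v' [w' [cs' [f' [Bs' [As' [wE -> tr' sr' _]]]]]]].
  have U1 : uniq (x :: v) by ucnt.
  have U2 : uniq (x' :: v') by rewrite wE in U; ucnt.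
  have sz := trep_size U1 U2 tr tr'.
  move/eqP: wE; rewrite -!cat_cons eqseq_cat // => /andP[/eqP vE /eqP wE].
  case: vE => xE vE; rewrite -xE -vE -wE in tr' sr' *.
  have U3 : uniq w by ucnt.
  by rewrite (IHt U1 _ tr'); have [-> -> ->] := IHs U3 _ _ _ sr'.
- by move=> _ cs' Bs' As' /srep_inv[[_ [-> _ -> ->]]//|[u [a [v [w1 [cs1 [tA [tB [ts1 [fA [fB [Bs1 [As1 []]]]]]]]]]]]]].
- move=> u a v w cs tA tB ts fA fB Bs As trA IHA trB IHB _ IHs U cs' Bs' As'.
  case/srep_inv=> [[_ []] //|[u' [a' [v' [w' [cs1 [tA' [tB' [ts1 [fA' [fB' [Bs1 [As1]]]]]]]]]]]]].
  case=> wE -> [<- <- <-] [-> ->] [trA' trB' sr'].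
  have U1 : uniq (rcons u a) by ucnt.
  have U2 : uniq (a :: v) by ucnt.
  have U3 : uniq w by ucnt.
  have U1' : uniq (rcons u' a') by rewrite wE in U; ucnt.
  have U2' : uniq (a' :: v') by rewrite wE in U; ucnt.
  have sz1 := trep_size U1 U1' trA trA'.
  have sz2 := trep_size U2 U2' trB trB'.
  move/eqP: wE; rewrite -!cat_rcons eqseq_cat // => /andP[/eqP/rcons_inj[uE aE] E].
  move: E; rewrite eqseq_cat; last by case: sz2.
  case/andP=> /eqP vE /eqP wE; rewrite -uE -aE -vE -wE in trA' trB' sr' *.
  rewrite (IHA U1 _ trA') (IHB U2 _ trB').
  by have [-> -> ->] := IHs U3 _ _ _ sr'.
Qed.

(** A swap at the end would need an earlier factor commuting with s; other swaps only reorder the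
    earlier factors, so the condition persists. *)
Lemma fequiv_last n (s : {perm 'I_n}) p qs :
  (forall r, r \in p -> r * s <> s * r) -> fequiv (rcons p s) qs ->
  exists p', qs = rcons p' s.
Proof.
move=> nc E; pose P qs := exists p', qs = rcons p' s /\ forall r, r \in p' -> r * s <> s * r.
suff Pstep fs gs : swap_step fs gs -> P fs -> P gs.
  have P0 : P (rcons p s) by exists p.
  by have [p' [-> _]] := fequiv_inv Pstep E P0; exists p'.
case=> [a [b [r [t [-> -> rt]]]]] [p1] {p nc E}.
case/lastP: b => [|b y] [E nc].
  rewrite -[[:: r; t]]/(rcons [:: r] t) -rcons_cat in E; case/rcons_inj: E => pE tE.
  by case: (nc r); rewrite -?pE ?mem_cat ?mem_head ?orbT // -tE.
rewrite -!rcons_cons -rcons_cat in E; case/rcons_inj: E => pE yE.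
exists (a ++ t :: r :: b); rewrite -!rcons_cons -rcons_cat yE; split=> // q qin.
by apply: nc; move: qin; rewrite -pE !mem_cat !inE => /or4P[] ->; rewrite ?orbT.
Qed.

(** If p' were longer, g would send the last letter of p both back to the head of p and on to the
    next letter of p'. *)
Lemma cut_le n (p p' w w' : seq 'I_n) (g : {perm 'I_n}) :
  p != [::] -> uniq (p ++ w) -> p ++ w = p' ++ w' -> (size p <= size p')%N ->
  (forall z, z \in p -> g z = cyc p z) -> (forall z, z \in p' -> g z = cyc p' z) -> p = p'.
Proof.
move=> pN U E sz gp gp'.
have [z zE] : exists z, p' = p ++ z.
  exists (drop (size p) p'); rewrite -[LHS](cat_take_drop (size p)); congr (_ ++ _).
  have := congr1 (take (size p)) E; rewrite take_size_cat // takel_cat // => ->.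
case: z zE => [|y z] zE; first by rewrite zE cats0.
case: p pN U E sz gp zE => [//|x u] _ U E sz gp zE.
have U' : uniq p' by rewrite E in U; ucnt.
have U1 : uniq (x :: u) by ucnt.
have pE : (x :: u) ++ y :: z = belast x u ++ last x u :: y :: z by rewrite lastI cat_rcons.
have lp' : last x u \in p' by rewrite zE mem_cat mem_last.
have := gp' _ lp'; rewrite gp ?mem_last // cyc_last //.
rewrite {1}zE pE cyc_next -?pE -?zE // => xy.
by rewrite zE -xy in U'; exfalso; cnt x.
Qed.

Lemma cut_eq n (p p' w w' : seq 'I_n) (g : {perm 'I_n}) :
  p != [::] -> p' != [::] -> uniq (p ++ w) -> p ++ w = p' ++ w' ->
  (forall z, z \in p -> g z = cyc p z) -> (forall z, z \in p' -> g z = cyc p' z) ->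
  p = p' /\ w = w'.
Proof.
move=> pN pN' U E gp gp'.
have pE : p = p'.
  case/orP: (leq_total (size p) (size p')) => sz.
    exact: cut_le pN U E sz gp gp'.
  by symmetry; apply: cut_le (esym E) sz gp' gp => //; rewrite -E.
by split=> //; move: E; rewrite pE => /eqP; rewrite eqseq_cat // eqxx => /eqP.
Qed.

Lemma filter_supp_none n (w1 w2 : seq 'I_n) fs :
  (forall x y, x \in w1 -> x \in w2 -> y \in w1 -> y \in w2 -> x = y) ->
  all (@is_cycle_ge2 n) fs -> all (supp_in w1) fs -> filter (supp_in w2) fs = [::].
Proof.
move=> meet1 /allP cfs /allP s1; rewrite (eq_in_filter (a2 := pred0)) ?filter_pred0 // => s sfs.
exact/negbTE/(cycle_supp_in2 meet1 (cfs s sfs) (s1 s sfs)).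
Qed.

Lemma filter_supp_all n (w : seq 'I_n) fs :
  all (supp_in w) fs -> filter (supp_in w) fs = fs.
Proof. by move/all_filterP. Qed.

Lemma cat_uniq_letter n (u u' r r' : seq 'I_n) a : uniq (u ++ a :: r) ->
  u ++ a :: r = u' ++ a :: r' -> u = u' /\ r = r'.
Proof.
move=> U E; have U' : uniq (u' ++ a :: r') by rewrite -E.
case/(@cat_split 'I_n u): E => [[q1 uE _]|[[|b p1] uE]] /=.
- by rewrite uE in U; exfalso; cnt a.
- by case=> ->; rewrite uE cats0.
- by case=> ab _; rewrite uE -ab in U'; exfalso; cnt a.
Qed.

Lemma prod_cat_in n (p w : seq 'I_n) fs gs z : \prod_(s <- fs) s = cyc p ->
  all (supp_in w) gs -> (forall y, y \in p -> y \notin w) -> z \in p ->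
  (\prod_(s <- fs ++ gs) s) z = cyc p z.
Proof.
move=> pE /supp_in_prod sg dis zp; rewrite big_cat /= pE permM.
by rewrite (supp_inP _ _ sg) // dis // supp_in_closed ?supp_in_cyc.
Qed.

(** Let a be the head of [cs]. A factor r of [fs] that moves x sends it into v: r then s takes x to
    r x, while s then r takes x to a. So [fequiv_last] applies to the factors moving x. Deletion
    removes only one factor, as s moves both x and a, while [fs] fixes a and [Bs], [As] fix x. *)
Lemma node_filter n (x : 'I_n) v w cs ts fs Bs As (s := cyc (x :: cs)) :
  uniq (x :: v ++ w) -> all (supp_in (x :: v)) fs -> srep w cs ts Bs As -> cs != [::] ->
  [/\ uniq (x :: cs),
      filter (fun r : {perm 'I_n} => r x != x) (fs ++ Bs ++ s :: As) =
        rcons (filter (fun r : {perm 'I_n} => r x != x) fs) s,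
      forall r, r \in filter (fun r : {perm 'I_n} => r x != x) fs -> r * s <> s * r &
      filter (fun r => r != s) (fs ++ Bs ++ s :: As) = fs ++ Bs ++ As].
Proof.
move=> U sf sr csN; have [sub sB sA] := srep_supp sr.
have Uw : uniq w by ucnt.
have xw : x \notin w by cnt x.
have Uc : uniq (x :: cs).
  by rewrite /= (subseq_uniq (srep_cs_subseq sr) Uw) andbT; apply: contra xw => /sub.
have [a csE] : exists a, head x cs = a /\ a \in cs by case: (cs) csN => // a l; exists a; rewrite mem_head.
case: csE => aE acs; have aw := sub a acs.
have sx : s x = a by rewrite /s; case: (cs) csN aE Uc => //= c l _ <- Uc; rewrite cyc_head.
have ax : a != x by apply: contraNneq xw => <-.
have sa : s a != a.
  by apply: cyc_neq; rewrite // ?inE ?acs ?orbT //; case: (cs) csN.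
have fixx gs : all (supp_in w) gs -> forall r, r \in gs -> r x = x.
  by move=> /allP sg r /sg /supp_inP ->.
have fixa r : r \in fs -> r a = a.
  by move=> /(allP sf) /supp_inP -> //; cnt a.
have none gs : all (supp_in w) gs -> filter (fun r : {perm 'I_n} => r x != x) gs = [::].
  move=> sg; rewrite (eq_in_filter (a2 := pred0)) ?filter_pred0 // => r /(fixx _ sg) ->.
  by rewrite eqxx.
have idf gs : (forall r, r \in gs -> r != s) -> filter (fun r => r != s) gs = gs.
  by move=> h; apply/all_filterP/allP.
split=> //.
- by rewrite !filter_cat /= (none Bs sB) (none As sA) sx ax /= cats1.
- move=> r; rewrite mem_filter => /andP[rx rfs] /(congr1 (fun t : {perm 'I_n} => t x)).
  have sr' := allP sf r rfs; rewrite !permM sx fixa // => E.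
  have rxv : r x \in x :: v by rewrite supp_in_closed ?mem_head.
  move: E; rewrite cyc_out => [E|]; first by rewrite E in rxv; cnt a.
  rewrite inE (negbTE rx) /=; apply/negP => /sub rxw; move: rxv rxw; set y := r x => ? ?; cnt y.
- rewrite !filter_cat /= eqxx !idf //= => r rin; apply: contraNneq ax => rs.
  + by rewrite -sx -rs (fixx As).
  + by rewrite -sx -rs (fixx Bs).
  + by move: sa; rewrite -rs fixa ?eqxx.
Qed.

Lemma rep_inj n :
  (forall (w : seq 'I_n) t fs, trep w t fs -> uniq w ->
     forall t' fs', trep w t' fs' -> fequiv fs fs' -> t = t') /\
  (forall (w cs : seq 'I_n) ts Bs As, srep w cs ts Bs As -> uniq w ->
     forall ts' Bs' As', srep w cs ts' Bs' As' -> fequiv (Bs ++ As) (Bs' ++ As') -> ts = ts').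
Proof.
apply: trep_srep_ind.
(* A leaf has no factors and a node has at least its own cycle. *)
- move=> x _ [[|t0 ts]] fs' /trep_inv //= [x' [v' [w' [cs' [f' [Bs' [As' [_ -> _ _ _]]]]]]]].
  by move/fequiv_perm/perm_size; rewrite !size_cat /= !addnS.
- move=> x v w cs t ts fs Bs As tr IHt sr IHs csN U [[|t0 ts']] fs' /trep_inv /=.
    by case=> -> _ /fequiv_perm/perm_size; rewrite !size_cat /= !addnS.
  case=> x' [v' [w' [cs' [f' [Bs' [As' [wE -> tr' sr' csN']]]]]]] E.
  have xE : x = x' by case: wE.
  rewrite -{}xE in wE tr' E.
  have U' : uniq (x :: v' ++ w') by rewrite -wE.
  have [sub sB sA] := srep_supp sr; have [sub' sB' sA'] := srep_supp sr'.
  have [sf sf'] := (trep_supp tr, trep_supp tr').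
  have [Uc F1 nc G1] := node_filter U sf sr csN.
  have [Uc' F1' _ G1'] := node_filter U' sf' sr' csN'.
  (* Among the factors that move x, the vertex cycle is last in both lists, so the two vertex cycles
     agree. *)
  have := fequiv_filter (fun r : {perm 'I_n} => r x != x) E.
  rewrite F1 F1' => /(fequiv_last nc)[p' /rcons_inj[_ sE]].
  have csE := cyc_inj Uc' Uc sE; rewrite csE in E sr' G1'.
  have := fequiv_filter (fun r => r != cyc (x :: cs)) E.
  rewrite G1 G1' => {}E.
  have U1 : uniq (x :: v) by ucnt.
  have U1' : uniq (x :: v') by ucnt.
  have U2 : uniq w by ucnt.
  (* Without the vertex cycle the product closes up on x v, which shows where v ends. *)
  have [||||||pE wE'] := @cut_eq n (x :: v) (x :: v') w w' (\prod_(s <- fs ++ Bs ++ As) s) => //.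
  + move=> z; apply: (prod_cat_in (w := w)); rewrite ?((rep_prod n).1 _ _ _ tr) ?all_cat ?sB //.
    by move=> y yv; cnt y.
  + move=> z; rewrite (fequiv_prod E).
    apply: (prod_cat_in (w := w')); rewrite ?((rep_prod n).1 _ _ _ tr') ?all_cat ?sB' //.
    by move=> y yv; cnt y.
  rewrite -{}pE -{}wE' in tr' sr' sf' sB' sA' *.
  have cf := (rep_cycles n).1 _ _ _ tr U1; have cf' := (rep_cycles n).1 _ _ _ tr' U1.
  have /andP[cB cA] := (rep_cycles n).2 _ _ _ _ _ sr U2.
  have /andP[cB' cA'] := (rep_cycles n).2 _ _ _ _ _ sr' U2.
  have d1 y z : y \in w -> y \in x :: v -> z \in w -> z \in x :: v -> y = z.
    by move=> y1 y2; exfalso; cnt y.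
  have d2 y z : y \in x :: v -> y \in w -> z \in x :: v -> z \in w -> y = z.
    by move=> y1 y2; exfalso; cnt y.
  have Ef := fequiv_filter (supp_in (x :: v)) E.
  rewrite !filter_cat (filter_supp_none d1 cB sB) (filter_supp_none d1 cA sA) (filter_supp_none d1 cB' sB') (filter_supp_none d1 cA' sA')
    (filter_supp_all sf) (filter_supp_all sf') !cats0 in Ef.
  have Eg := fequiv_filter (supp_in w) E.
  rewrite !filter_cat (filter_supp_none d2 cf sf) (filter_supp_none d2 cf' sf')
    (filter_supp_all sB) (filter_supp_all sA) (filter_supp_all sB') (filter_supp_all sA') /= in Eg.
  by rewrite (IHt U1 _ _ tr' Ef) (IHs U2 _ _ _ sr' Eg).
- by move=> _ ts' Bs' As' /srep_inv[[_ []]//|[u [a [v [w1 [cs1 [tA [tB [ts1 [fA [fB [Bs1 [As1 []]]]]]]]]]]]]].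
- move=> u a v w cs tA tB ts fA fB Bs As trA IHA trB IHB sr IHs U ts' Bs' As'.
  case/srep_inv=> [[_ []] //|[u' [a' [v' [w' [cs1 [tA' [tB' [ts1 [fA' [fB' [Bs1 [As1]]]]]]]]]]]]].
  case=> wE [aE csE] -> [-> ->] [trA' trB' sr'] E; rewrite -{}aE -{}csE in wE trA' trB' sr'.
  have U' : uniq (u' ++ a :: v' ++ w') by rewrite -wE.
  have [uE vwE] := cat_uniq_letter U wE.
  rewrite -{}uE in wE trA' U'.
  have [sub sB sA] := srep_supp sr; have [sub' sB' sA'] := srep_supp sr'.
  have [sfA sfB] := (trep_supp trA, trep_supp trB).
  have [sfA' sfB'] := (trep_supp trA', trep_supp trB').
  have U1 : uniq (rcons u a) by ucnt.
  have U2 : uniq (a :: v) by ucnt.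
  have U3 : uniq w by ucnt.
  have U2' : uniq (a :: v') by ucnt.
  (* [B0] is disjoint from u a, so the factors on u a v0 can be brought together in front, where
     they multiply to the cycle of that word. *)
  have piece v0 w0 f0 g0 B0 A0 z : uniq (u ++ a :: v0 ++ w0) ->
      \prod_(s <- f0) s = cyc (a :: v0) -> \prod_(s <- g0) s = cyc (rcons u a) ->
      all (supp_in w0) B0 -> all (supp_in w0) A0 -> z \in u ++ a :: v0 ->
      (\prod_(s <- (f0 ++ B0) ++ (g0 ++ A0)) s) z = cyc (u ++ a :: v0) z.
    move=> U0 p0 q0 sB0 sA0.
    have E0 : \prod_(s <- (f0 ++ B0) ++ g0 ++ A0) s = \prod_(s <- (f0 ++ g0) ++ (B0 ++ A0)) s.
      rewrite !big_cat /= -!mulgA; congr (_ * _); rewrite !mulgA; congr (_ * _).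
      rewrite q0; apply: (@supp_in_commute _ w0 (rcons u a)).
      - by move=> y yw; cnt y.
      - exact: supp_in_prod.
      - exact: supp_in_cyc.
    rewrite E0; apply: (prod_cat_in (w := w0)).
    - rewrite big_cat /= p0 q0 cyc_rot1; last by ucnt.
      by rewrite -cyc_cat -cat_cons cyc_rot //; ucnt.
    - by rewrite all_cat sB0.
    - by move=> y yv; cnt y.
  have wE2 : (u ++ a :: v) ++ w = (u ++ a :: v') ++ w' by rewrite -!catA.
  have N0 v0 : u ++ a :: v0 != [::] by case: (u).
  have Uw : uniq ((u ++ a :: v) ++ w) by rewrite -catA.
  have [||pE wE'] := cut_eq (N0 v) (N0 v') Uw wE2 (g := \prod_(s <- (fB ++ Bs) ++ fA ++ As) s).
  + by move=> z; exact: (piece _ _ _ _ _ _ _ U ((rep_prod n).1 _ _ _ trB U2) ((rep_prod n).1 _ _ _ trA U1) sB sA).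
  + move=> z; rewrite (fequiv_prod E).
    exact: (piece _ _ _ _ _ _ _ U' ((rep_prod n).1 _ _ _ trB' U2') ((rep_prod n).1 _ _ _ trA' U1) sB' sA').
  have vE : v = v' by move/eqP: pE; rewrite eqseq_cat // eqxx => /eqP[].
  rewrite -{}vE -{}wE' in trB' sr' sfB' sB' sA' *.
  have cfA := (rep_cycles n).1 _ _ _ trA U1; have cfA' := (rep_cycles n).1 _ _ _ trA' U1.
  have cfB := (rep_cycles n).1 _ _ _ trB U2; have cfB' := (rep_cycles n).1 _ _ _ trB' U2.
  have /andP[cB cA] := (rep_cycles n).2 _ _ _ _ _ sr U3.
  have /andP[cB' cA'] := (rep_cycles n).2 _ _ _ _ _ sr' U3.
  (* Distinct segments meet in at most one letter, so filtering by support isolates the factors of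
     each. *)
  have onlya y : y \in rcons u a -> y \in a :: v -> y = a.
    move=> y1 y2; apply/esym/eqP/contraT; rewrite eqoE => ay; cnt y.
  have d12 y z : y \in rcons u a -> y \in a :: v -> z \in rcons u a -> z \in a :: v -> y = z.
    by move=> y1 y2 z1 z2; rewrite (onlya y) // (onlya z).
  have d21 y z : y \in a :: v -> y \in rcons u a -> z \in a :: v -> z \in rcons u a -> y = z.
    by move=> y1 y2 z1 z2; rewrite (onlya y) // (onlya z).
  have d13 y z : y \in rcons u a -> y \in w -> z \in rcons u a -> z \in w -> y = z.
    by move=> y1 y2; exfalso; cnt y.
  have d31 y z : y \in w -> y \in rcons u a -> z \in w -> z \in rcons u a -> y = z.
    by move=> y1 y2; exfalso; cnt y.
  have d23 y z : y \in a :: v -> y \in w -> z \in a :: v -> z \in w -> y = z.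
    by move=> y1 y2; exfalso; cnt y.
  have d32 y z : y \in w -> y \in a :: v -> z \in w -> z \in a :: v -> y = z.
    by move=> y1 y2; exfalso; cnt y.
  have E1 := fequiv_filter (supp_in (rcons u a)) E.
  rewrite !filter_cat (filter_supp_none d21 cfB sfB) (filter_supp_none d21 cfB' sfB')
    (filter_supp_none d31 cB sB) (filter_supp_none d31 cA sA) (filter_supp_none d31 cB' sB') (filter_supp_none d31 cA' sA')
    (filter_supp_all sfA) (filter_supp_all sfA') !cats0 /= in E1.
  have E2 := fequiv_filter (supp_in (a :: v)) E.
  rewrite !filter_cat (filter_supp_none d12 cfA sfA) (filter_supp_none d12 cfA' sfA')
    (filter_supp_none d32 cB sB) (filter_supp_none d32 cA sA) (filter_supp_none d32 cB' sB') (filter_supp_none d32 cA' sA')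
    (filter_supp_all sfB) (filter_supp_all sfB') !cats0 /= in E2.
  have E3 := fequiv_filter (supp_in w) E.
  rewrite !filter_cat (filter_supp_none d13 cfA sfA) (filter_supp_none d13 cfA' sfA')
    (filter_supp_none d23 cfB sfB) (filter_supp_none d23 cfB' sfB')
    (filter_supp_all sB) (filter_supp_all sA) (filter_supp_all sB') (filter_supp_all sA') /= in E3.
  by rewrite (IHA U1 _ _ trA' E1) (IHB U2 _ _ trB' E2) (IHs U3 _ _ _ sr' E3).
Qed.

(** * Trees of the given type *)

Definition bad_deg : pred nat := fun d => ~~ ((d == 1%N) || (~~ odd d && (4 <= d)%N)).

Lemma split_word (T : Type) (w : seq T) p r : size w = (p + r).+1 ->
  {u : seq T & {a : T & {v : seq T | w = u ++ a :: v & size u = p /\ size v = r}}}.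
Proof.
move=> sw; case E : (drop p w) => [|a v].
  by have := congr1 size E; rewrite size_drop sw /=; clear; lia.
exists (take p w), a, v; first by rewrite -E cat_take_drop.
have := congr1 size E; rewrite size_drop size_take sw /= => sv.
by split; [case: ltnP|]; move: sv; clear; lia.
Qed.

(** Kept in [Type], since the bijection is computed from the labelling. The successor accounts for a
    leaf at the other end of the parent edge, which makes the number of leaves even. *)
Definition labelable (n : nat) (t : ptree) : Type :=
  {m : nat & (cnt_nonroot (pred1 1%N) t).+1 = (2 * m)%N &
     forall w : seq 'I_n, size w = m -> {fs | trep w t fs}}.

Definition seq_labelable (n : nat) (ts : seq ptree) : Type :=
  {m : nat & sumn (map (cnt_nonroot (pred1 1%N)) ts) = (2 * m)%N &
     forall w : seq 'I_n, size w = m -> {x | srep w x.1.1 ts x.1.2 x.2}}.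

Lemma labelable_seq n k :
  (forall t, (cnt_nonroot predT t <= k)%N -> cnt_nonroot bad_deg t = 0 -> labelable n t) ->
  forall ts, (sumn (map (cnt_nonroot predT) ts) <= k)%N ->
    sumn (map (cnt_nonroot bad_deg) ts) = 0 -> ~~ odd (size ts) -> seq_labelable n ts.
Proof.
move=> IH ts; have [l] := ubnP (size ts); elim: l ts => // l IHl [|tA [|tB ts]] //= sz szk b0 ev.
  exists 0 => // w /size0nil ->; exists ([::], [::], [::]); exact: srep_nil.
have [mA cA hA] : labelable n tA by apply: IH; move: szk b0; clear; lia.
have [mB cB hB] : labelable n tB by apply: IH; move: szk b0; clear; lia.
have [m c h] : seq_labelable n ts.
  by apply: IHl; move: sz szk b0 ev; rewrite ?negbK; clear; lia.
(* The first two segments share the letter a. *)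
exists (mA + mB + m).-1%N; first by move: cA cB; rewrite /= c /=; clear; lia.
move=> w sw; have [|u [a [vw wE [su svw]]]] := @split_word _ w mA.-1 (mB.-1 + m).
  by move: cA cB; rewrite sw; clear; lia.
have sA : size (rcons u a) = mA by rewrite size_rcons su; move: cA; clear; lia.
have sB : size (a :: take mB.-1 vw) = mB.
  by rewrite /= size_take svw; case: ltnP; move: cB; clear; lia.
have sm : size (drop mB.-1 vw) = m by rewrite size_drop svw; clear; lia.
have [fA trA] := hA _ sA; have [fB trB] := hB _ sB; have [x sr] := h _ sm.
exists (a :: x.1.1, fB ++ x.1.2, fA ++ x.2).
by rewrite wE -(cat_take_drop mB.-1 vw); apply: srep_cons.
Qed.

Lemma srep_size n (w cs : seq 'I_n) ts Bs As :
  srep w cs ts Bs As -> size ts = (2 * size cs)%N.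
Proof.
by elim=> //= u a v {}w {}cs tA tB {}ts fA fB {}Bs {}As _ _ _ ->; clear; lia.
Qed.

Lemma labelable_tree n t : cnt_nonroot bad_deg t = 0 -> labelable n t.
Proof.
have [k] := ubnP (cnt_nonroot predT t); elim: k t => // k IH [[|t ts]] /= szk b0.
  exists 1%N => // -[|x [|//]] // _; exists [::]; exact: trep_leaf.
have [m cm h] : labelable n t by apply: IH; move: szk b0; clear; lia.
have [|||| ms cs hs] := @labelable_seq n (sumn (map (cnt_nonroot predT) ts)) _ ts.
- by move=> t' szt; apply: IH; move: szk szt; clear; lia.
- exact: leqnn.
- by move: b0; clear; lia.
(* The vertex has degree [size ts + 2], which is even. *)
- by move: b0; rewrite /bad_deg; clear; lia.
exists (m + ms)%N; first by move: cm; rewrite /= cs /=; clear; lia.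
move=> w sw; have sm : size (take m w) = m by rewrite size_take sw; case: ltnP; clear; lia.
have sms : size (drop m w) = ms by rewrite size_drop sw; clear; lia.
have [fs tr] := h _ sm; have [[[ds Bs] As] sr] := hs _ sms.
case E : (take m w) tr sm => [|x v] tr sm; first by move: sm cm => /= <-; clear; lia.
exists (fs ++ Bs ++ cyc (x :: ds) :: As).
rewrite -(cat_take_drop m w) E cat_cons; apply: (trep_node tr sr).
(* An empty [ds] would leave a vertex of degree 2, which [bad_deg] excludes. *)
apply/eqP => ds0; have := srep_size sr; rewrite ds0 => ts0; move: b0.
by rewrite ts0.
Qed.

Lemma cyc_enum n : (1 <= n)%N -> cyc (enum 'I_n) = ncycle n.
Proof.
move=> n0; apply/permP => x; rewrite cycE ?enum_uniq // permE next_nth mem_enum inE.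
have ix := index_enum_ord x; have := size_enum_ord n.
case E : (enum 'I_n) ix => [|y p] ix sz.
  by have := ltn_ord x; rewrite -[X in (_ < X)%N]sz.
rewrite ix; apply: val_inj => /=.
rewrite -[nth y p x]/(nth y (y :: p) x.+1) -E.
have := ltn_ord x; rewrite leq_eqVlt => /predU1P[xn|xn]; last first.
  by rewrite nth_enum_ord // modn_small.
(* At the last letter [nth] falls back on its default y, the letter 0, in agreement with n mod n =
   0. *)
rewrite nth_default ?size_enum_ord ?xn // modnn.
by have := @nth_enum_ord n y 0 n0; rewrite E.
Qed.

Lemma trep_mfact n (w : seq 'I_n) t fs : uniq w -> trep w t fs -> mfact w fs.
Proof.
move=> U tr; split; first exact: (rep_cycles n).1 tr U.
- exact: (rep_prod n).1 tr U.
- exact: (rep_wt n).1 tr U.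
Qed.

Lemma cnt_deg_root n (P : pred nat) t fs : (1 <= n)%N -> trep (enum 'I_n) t fs ->
  cnt_deg P (PNode [:: t]) = (P 1%N * (2 * n) + count (fun s => P (2 * cyc_len s)%N) fs)%N.
Proof.
move=> n0 tr; rewrite /= ((rep_cnt n P).1 _ _ _ tr (enum_uniq _)) size_enum_ord.
by move: n0; case: (P 1%N) => /=; clear; lia.
Qed.

Lemma tree_of_type_fact n alpha t fs : (1 <= n)%N -> trep (enum 'I_n) t fs ->
  tree_of_type n alpha (PNode [:: t]) <-> min_fact_of_type alpha fs.
Proof.
move=> n0 tr; have [cfs pE wE] := trep_mfact (enum_uniq _) tr.
have cntE j : (2 <= j)%N -> cnt_deg (fun d => d == (2 * j)%N) (PNode [:: t]) =
    count (fun s => cyc_len s == j) fs.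
  move=> j2; rewrite (cnt_deg_root _ n0 tr) (_ : (1 == 2 * j)%N = false); last by apply/negbTE; lia.
  by rewrite mul0n add0n; apply: eq_count => s /=; apply/eqP/eqP; lia.
split=> [[_ _ aE _]|[_ [aE _]]].
- split; first by split; rewrite // pE cyc_enum.
  split; first by move=> j j2; rewrite -cntE ?aE.
  by rewrite /is_minimal -/(wt fs) wE size_enum_ord.
- split=> //.
  + rewrite (cnt_deg_root _ n0 tr) /= mul1n (eq_count (a2 := pred0)) ?count_pred0 ?addn0 //.
    by move=> s /=; apply/negbTE; lia.
  + by move=> j j2; rewrite cntE ?aE.
  + rewrite (cnt_deg_root _ n0 tr) /=; apply/eqP; rewrite -leqn0 leqNgt -has_count.
    apply/hasPn => s /(allP cfs) /andP[]; rewrite -/(cyc_len s) => s2 _.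
    by move: s2; clear; lia.
Qed.

(** A boolean test on the leaves and the bad degrees decides whether to label; when it fails, the
    empty list is a mere default. *)
Lemma tree_labelling n alpha T : (1 <= n)%N ->
  {fs | tree_of_type n alpha T -> exists2 t, T = PNode [:: t] & trep (enum 'I_n) t fs}.
Proof.
move=> n0; case: T => [[|t [|? ?]]]; try by exists [::] => -[].
case E : ((cnt_nonroot bad_deg t == 0) && (cnt_nonroot (pred1 1%N) t == (2 * n).-1)); last first.
  exists [::] => -[_ c1 _ c2].
  have {}c1 : (1 + (cnt_nonroot (pred1 1%N) t + 0) = 2 * n)%N := c1.
  have {}c2 : (0 + (cnt_nonroot bad_deg t + 0) = 0)%N := c2.
  by case/negP: E; apply/andP; split; apply/eqP; move: c1 c2; clear; lia.
case/andP: E => /eqP b0 /eqP c1; have [m cm h] := labelable_tree n b0.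
have [|fs tr] := h (enum 'I_n); last by exists fs => _; exists t.
by rewrite size_enum_ord; move: n0 cm; rewrite c1; clear; lia.
Qed.

Theorem theorem1 (n : nat) (alpha : nat -> nat) (N : nat) :
  (1 <= n)%N ->
  (forall j, (N <= j)%N -> alpha j = 0%N) ->
  (\sum_(2 <= j < N) (j - 1) * alpha j)%N = (n - 1)%N ->
  exists f : ptree -> seq {perm 'I_n},
    [/\ (forall T, tree_of_type n alpha T -> min_fact_of_type alpha (f T)),
        (forall fs, min_fact_of_type alpha fs ->
           exists T, tree_of_type n alpha T /\ fequiv fs (f T)) &
        (forall T T', tree_of_type n alpha T -> tree_of_type n alpha T' ->
           fequiv (f T) (f T') -> T = T')].
Proof.
move=> n0 _ _; have U := enum_uniq 'I_n.
pose f T := sval (tree_labelling alpha T n0).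
have fP T : tree_of_type n alpha T -> exists2 t, T = PNode [:: t] & trep (enum 'I_n) t (f T).
  exact: svalP (tree_labelling alpha T n0).
exists f; split=> [T TP|fs fsP|T T' TP T'P].
- by have [t TE tr] := fP T TP; apply/(tree_of_type_fact _ n0 tr); rewrite -TE.
- have [[cfs pE] [aE wE]] := fsP.
  have wN : enum 'I_n != [::] by rewrite -size_eq0 size_enum_ord -lt0n.
  have [|t [fs' [tr E]]] := @trep_surj n (enum 'I_n) fs U wN.
    by split; rewrite // ?pE ?cyc_enum // size_enum_ord.
  have TP : tree_of_type n alpha (PNode [:: t]).
    apply/(tree_of_type_fact _ n0 tr); have [c p w] := trep_mfact U tr.
    split; first by split; rewrite // p cyc_enum.
    split; last by rewrite /is_minimal -/(wt fs') w size_enum_ord.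
    by move=> j j2; rewrite -aE //; apply/esym/seq.permP/fequiv_perm.
  (* [f] carries its own labelling of this tree, which [rep_det] identifies with [fs']. *)
  exists (PNode [:: t]); split=> //; have [_ [<-] tr'] := fP _ TP.
  by rewrite ((rep_det n).1 _ _ _ tr' U _ tr).
- have [t -> tr] := fP T TP; have [t' -> tr'] := fP T' T'P => E.
  by rewrite ((rep_inj n).1 _ _ _ tr U _ _ tr' E).
Qed.
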